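(* Let $d\geq 2$, let $T$ be the $d$-regular rooted tree, and let $G\leq\operatorname{Aut}(T)$ be a finitely generated branch group with the weak subgroup induction property. Then $G$ is torsion and just infinite. If moreover the intersection of all finite-index maximal subgroups of $G$ is not trivial (e.g. if $G$ is a $p$-group), then every maximal subgroup of $G$ is of finite index in $G$.
   Context: The vertices of the $d$-regular rooted tree $T$ are identified with the words in $\{1,\dots,d\}^*$; the root is the empty word, the children of $v$ are $v1,\dots,vd$, and $\mathcal L_n$ is the set of words of length $n$. $\operatorname{Aut}(T)$ is the group of automorphisms of $T$ (fixing the root). For a vertex $v$, $T_v$ is the subtree of all words with prefix $v$. For $g\in\operatorname{Aut}(T)$ and a vertex $v$, the section $\varphi_v(g)\in\operatorname{Aut}(T)$ is the unique automorphism with $g\cdot(vw)=(g\cdot v)(\varphi_v(g)\cdot w)$ for all $w\in T$; $\varphi_v$ is a homomorphism on the stabilizer of $v$. For $G\leq\operatorname{Aut}(T)$ and a set $V$ of vertices, $\operatorname{Stab}_G(V)$ is the pointwise stabilizer of $V$ in $G$. $\operatorname{Rist}_G(v)$ is the subgroup of elements of $G$ acting trivially outside $T_v$, and $\operatorname{Rist}_G(\mathcal L_n)$ is the subgroup generated by all $\operatorname{Rist}_G(v)$, $v\in\mathcal L_n$. $G$ is branch if it acts transitively on every $\mathcal L_n$, all $\operatorname{Rist}_G(v)$ are infinite, and every $\operatorname{Rist}_G(\mathcal L_n)$ has finite index in $G$. A transversal of $T$ is a set $X$ of vertices such that every infinite ray starting at the root passes through exactly one element of $X$ (such an $X$ is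 finite). $G$ has the weak subgroup induction property if for every finitely generated subgroup $H\leq G$ there is a transversal $X$ of $T$ such that for each $v\in X$ the group $\varphi_v(\operatorname{Stab}_H(X))$ is either trivial or of finite index in $\varphi_v(\operatorname{Stab}_G(v))$. A group is just infinite if it is infinite and all its proper quotients are finite. *)

(* Defs.v *)
From HB Require Import structures.
From mathcomp Require Import all_boot.
From mathcomp Require Import boolp classical_sets cardinality.

Set Implicit Arguments.
Unset Strict Implicit.
Unset Printing Implicit Defensive.

Local Open Scope classical_set_scope.
Local Open Scope group_scope.

(* Groups are subgroups of a possibly infinite [groupType], represented by     *)
(* their carriers, which are classical sets.                                   *)

Section GroupTheory.
Variable gT : groupType.
Implicit Types (A G H K M N : set gT) (p : nat).

Definition is_subgroup H : Prop := group_closed [in H].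

Definition generated A : set gT := smallest is_subgroup A.

Definition finitely_generated G : Prop :=
  exists2 A : set gT, finite_set A & G = generated A.

Definition left_coset H (g : gT) : set gT := [set g * h | h in H].

(* When N is normal in G, this is the underlying set of the quotient G/N. *)
Definition left_cosets G H : set (set gT) := [set left_coset H g | g in G].

Definition finite_index G H : Prop := finite_set (left_cosets G H).

Definition normal_subgroup G N : Prop :=
  [/\ is_subgroup N, N `<=` G & forall g n, G g -> N n -> N (n ^ g)].

Definition just_infinite G : Prop :=
  infinite_set G /\
  forall N, normal_subgroup G N -> N <> [set 1] -> finite_set (left_cosets G N).

Definition torsion G : Prop :=
  forall g, G g -> exists2 n, (0 < n)%N & g ^+ n = 1.

Definition p_group p G : Prop :=
  forall g, G g -> exists k, g ^+ (p ^ k)%N = 1.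

Definition maximal_subgroup G M : Prop :=
  [/\ is_subgroup M, M `<` G &
      forall K, is_subgroup K -> M `<=` K -> K `<=` G -> K = M \/ K = G].

Definition finite_index_Frattini G : set gT :=
  G `&` \bigcap_(M in [set M | maximal_subgroup G M /\ finite_index G M]) M.

End GroupTheory.

Section Tree.
Variable d : nat.

Definition vertex : Type := seq 'I_d.

Implicit Types (u v w : vertex).

Definition child v w : Prop := exists i : 'I_d, w = rcons v i.

Definition adjacent v w : Prop := child v w \/ child w v.

Record tree_aut : Type := TreeAut {
  tree_fun :> vertex -> vertex;
  tree_fun_bij : bijective tree_fun;
  tree_fun_root : tree_fun [::] = [::];
  tree_fun_adj : forall v w,
    adjacent (tree_fun v) (tree_fun w) <-> adjacent v w }.

Implicit Types g h : tree_aut.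

Lemma tree_autP g h : (forall v, g v = h v) -> g = h.
Proof.
case: g h => [f fb fr fa] [f' fb' fr' fa'] /= /funext E.
by case: _ / E in fb' fr' fa' *; congr TreeAut; exact: Prop_irrelevance.
Qed.

HB.instance Definition _ := gen_eqMixin tree_aut.
HB.instance Definition _ := gen_choiceMixin tree_aut.

Definition tree_one : tree_aut.
Proof. by apply: (@TreeAut id) => //; exists id. Defined.

(* Automorphisms act on the left: (g * h) v = g (h v). *)
Definition tree_mul g h : tree_aut.
Proof.
apply: (@TreeAut (g \o h)).
- exact: bij_comp (tree_fun_bij g) (tree_fun_bij h).
- by rewrite /= !tree_fun_root.
- by move=> v w; rewrite /= !tree_fun_adj.
Defined.

Lemma tree_inv_subproof g : {f : vertex -> vertex | cancel f g /\ cancel g f}.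
Proof. by apply: cid; case: (tree_fun_bij g) => f; exists f. Qed.

Definition tree_inv g : tree_aut.
Proof.
case: (tree_inv_subproof g) => f [fK gK]; apply: (@TreeAut f).
- by exists g.
- by rewrite -{1}(tree_fun_root g) gK.
- by move=> v w; rewrite -(tree_fun_adj g) !fK.
Defined.

Lemma tree_mulA : associative tree_mul.
Proof. by move=> g h k; apply: tree_autP. Qed.
Lemma tree_mul1 : left_id tree_one tree_mul.
Proof. by move=> g; apply: tree_autP. Qed.
Lemma tree_mulr1 : right_id tree_one tree_mul.
Proof. by move=> g; apply: tree_autP. Qed.
Lemma tree_mulV : left_inverse tree_one tree_inv tree_mul.
Proof.
move=> g; apply: tree_autP => v /=; rewrite /tree_inv.
by case: tree_inv_subproof => f [fK gK] /=; rewrite gK.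
Qed.
Lemma tree_mulrV : right_inverse tree_one tree_inv tree_mul.
Proof.
move=> g; apply: tree_autP => v /=; rewrite /tree_inv.
by case: tree_inv_subproof => f [fK gK] /=; rewrite fK.
Qed.

HB.instance Definition _ := isGroup.Build tree_aut
  tree_mulA tree_mul1 tree_mulr1 tree_mulV tree_mulrV.

Lemma tree_invK g : cancel g (tree_inv g).
Proof. by move=> v; have := congr1 (@tree_fun ^~ v) (tree_mulV g). Qed.

Lemma tree_invKV g : cancel (tree_inv g) g.
Proof. by move=> v; have := congr1 (@tree_fun ^~ v) (tree_mulrV g). Qed.

Lemma tree_aut_inj g : injective g.
Proof. exact: bij_inj (tree_fun_bij g). Qed.

Lemma tree_aut_child g v w : child v w -> child (g v) (g w).
Proof.
elim/last_ind: v w => [|v j IH] w vw.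
  have /tree_fun_adj-/(_ g) : adjacent [::] w by left.
  by rewrite tree_fun_root => -[//|[i]]; case: (g w).
have /tree_fun_adj-/(_ g)[//|[i e]] : adjacent (rcons v j) w by left.
have [k e'] : child (g v) (g (rcons v j)) by apply: IH; exists j.
have : g w = g v by move: e; rewrite e' => /rcons_inj[].
move=> /tree_aut_inj wv; case: vw => l /(congr1 size).
by rewrite wv !size_rcons => /eqP; rewrite -[X in X == _]addn0 -addn2 eqn_add2l.
Qed.

Lemma size_tree_aut g v : size (g v) = size v.
Proof.
elim/last_ind: v => [|v i IH]; first by rewrite tree_fun_root.
have [|j ->] := @tree_aut_child g v (rcons v i); first by exists i.
by rewrite !size_rcons IH.
Qed.

Lemma tree_aut_cat g v w : g (v ++ w) = g v ++ drop (size v) (g (v ++ w)).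
Proof.
elim/last_ind: w => [|w i IH].
  by rewrite cats0 drop_oversize ?size_tree_aut// cats0.
have [|j] := @tree_aut_child g (v ++ w) (v ++ rcons w i).
  by exists i; rewrite rcons_cat.
by move=> ->; rewrite IH rcons_cat drop_size_cat ?size_tree_aut.
Qed.

Definition section_fun v g w : vertex := drop (size v) (g (v ++ w)).

Lemma section_funE v g w : g (v ++ w) = g v ++ section_fun v g w.
Proof. exact: tree_aut_cat. Qed.

Lemma child_cat v w1 w2 : child (v ++ w1) (v ++ w2) <-> child w1 w2.
Proof.
split=> -[i e]; exists i; last by rewrite e rcons_cat.
move: e; rewrite rcons_cat => /(congr1 (drop (size v))).
by rewrite !drop_size_cat.
Qed.

(* The section of g at v, characterised by [sectionE] and [section_unique].    *)
Definition section v g : tree_aut.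
Proof.
apply: (@TreeAut (section_fun v g)).
- exists (section_fun (g v) (tree_inv g)) => w.
    by rewrite {1}/section_fun -section_funE tree_invK drop_size_cat ?size_tree_aut.
  have := section_funE (g v) (tree_inv g) w; rewrite tree_invK => e.
  by rewrite {1}/section_fun -e tree_invKV drop_size_cat ?size_tree_aut.
- by rewrite /section_fun cats0 drop_oversize ?size_tree_aut.
- move=> w1 w2; rewrite /adjacent -(child_cat (g v)) -(child_cat (g v) (_ w2)).
  by rewrite -!section_funE -/(adjacent _ _) tree_fun_adj /adjacent !child_cat.
Defined.

Lemma sectionE v g w : g (v ++ w) = g v ++ section v g w.
Proof. exact: section_funE. Qed.

Lemma section_unique v g h :
  (forall w, g (v ++ w) = g v ++ h w) -> h = section v g.
Proof.
move=> hE; apply: tree_autP => w.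
by have /(congr1 (drop (size (g v)))) := hE w; rewrite sectionE !drop_size_cat.
Qed.

Implicit Types (G H : set tree_aut) (V X : set vertex).

Definition Stab G V : set tree_aut :=
  [set g | G g /\ forall v, V v -> g v = v].

Definition Rist G v : set tree_aut :=
  [set g | G g /\ forall w, ~~ prefix v w -> g w = w].

Definition Rist_level G (n : nat) : set tree_aut :=
  generated (\bigcup_(v in [set v | size v = n]) Rist G v).

Definition level_transitive G : Prop :=
  forall (n : nat) v w, size v = n -> size w = n -> exists2 g, G g & g v = w.

Definition branch G : Prop :=
  [/\ level_transitive G,
      forall v, infinite_set (Rist G v) &
      forall n : nat, finite_index G (Rist_level G n)].

Definition ray (r : nat -> vertex) : Prop :=
  r 0%N = [::] /\ forall n, child (r n) (r n.+1).

Definition transversal X : Prop :=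
  forall r, ray r -> exists! v, X v /\ exists n, r n = v.

Definition weak_subgroup_induction G : Prop :=
  forall H, is_subgroup H -> H `<=` G -> finitely_generated H ->
  exists2 X, transversal X &
    forall v, X v ->
      section v @` Stab H X = [set 1] \/
      finite_index (section v @` Stab G [set v]) (section v @` Stab H X).

End Tree.

(* Main.v *)
From mathcomp Require Import all_boot all_fingroup all_solvable.
From mathcomp Require Import boolp classical_sets cardinality.
Require Import Defs.

(** The engine is a commutator identity. Write T_y for the subtree at y. If l
    moves y, and a, b act only inside T_y, then [~ l, a] is a times an element
    supported in a subtree disjoint from T_y, so that [~ [~ l, a], b] equals
    [~ a, b] (commg_Rist). Hence a subgroup H that is stable under enough
    commutators and contains an element moving y contains all commutators of
    Rist_G(y); when this happens for all y of one level, H contains the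
    commutator subgroup of Rist_G(L_m). If G is finitely generated and torsion,
    this has finite index in Rist_G(L_m), since a finitely generated torsion
    abelian group is finite, and so H has finite index in G
    (finite_index_Rist_commutators). For a nontrivial normal subgroup this says
    that G is just infinite.

    Torsion. Apply weak subgroup induction to the cyclic group generated by g,
    and let v be in the transversal. Either a power of g is trivial on T_v, or
    the sections at v of powers of g have finite index in those of G. In the
    second case they meet the infinite rigid stabilisers of two distinct
    children of v: some g^i and g^j act on T_v with disjoint supports, and
    g^(ij) is trivial on T_v. As the transversal is bounded, finitely many
    subtrees are involved and some power of g is trivial.

    Maximal subgroups. If M is maximal of infinite index and the intersection F
    of the maximal subgroups of finite index is nontrivial, then F has finite
    index and MF = G. Finitely many elements of M that generate G modulo F
    generate a subgroup H that lies in no proper subgroup of finite index, that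
    is, H L = G for all L of finite index (maximal_infinite_index_dense). It
    remains to see that such an H is G (fg_dense_full). Let n bound the depth
    of the transversal given for H, and let S be the stabiliser of level n in
    H. Density makes H transitive on levels; so one trivial section group would
    make S trivial, which density excludes. All sections of S are thus of finite
    index. Density then yields, for distinct w, w' of length n and every
    subtree below w, an element of S trivial on T_w' and not on that subtree:
    otherwise the action on T_w' would determine the action on the subtree,
    and the two could not be prescribed independently modulo finite index
    subgroups (dense_independent). The commutator identity turns such elements
    into elements of S rigid below w and trivial on T_w', and commutators of
    those, for all w', into a nontrivial element of Rist_H(w)
    (dense_meets_Rist). Since H and G have the same sections at w, the identity
    now puts the commutators of some Rist_G(x) into H; so H has finite index,
    and density gives H = G.

    For a p-group, every maximal subgroup of finite index contains all
    commutators, since maximal subgroups of finite p-groups are normal of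
    index p; and G is not abelian. *)

Set Implicit Arguments.
Unset Strict Implicit.
Unset Printing Implicit Defensive.

Local Open Scope classical_set_scope.
Local Open Scope group_scope.

(** * Subgroups of finite index *)

Section Groups.
Variable gT : groupType.
Implicit Types (A C G H K L M N : set gT) (x y g : gT).

Lemma subgroupP H : is_subgroup H <->
  [/\ H 1, forall x y, H x -> H y -> H (x * y) & forall x, H x -> H x^-1].
Proof.
split=> [[]|[H1 HM HV]].
  rewrite inE => H1 HD; have HV x : H x -> H x^-1.
    by move=> Hx; have := HD 1 x; rewrite !inE mul1g; apply.
  split=> // x y Hx Hy.
  by have := HD x y^-1; rewrite !inE invgK; apply; [|exact: HV].
split=> [|x y]; rewrite !inE // => Hx Hy; exact/HM/HV.
Qed.

Section Closure.
Variables (H : set gT) (subH : is_subgroup H).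

Lemma subgroup1 : H 1.
Proof. by case/subgroupP: subH. Qed.

Lemma subgroupM x y : H x -> H y -> H (x * y).
Proof. by case/subgroupP: subH => _ + _; apply. Qed.

Lemma subgroupV x : H x -> H x^-1.
Proof. by case/subgroupP: subH => _ _; apply. Qed.

Lemma subgroupJ x y : H x -> H y -> H (x ^ y).
Proof. by move=> Hx Hy; do !apply: subgroupM => //; apply: subgroupV. Qed.

Lemma subgroupR x y : H x -> H y -> H [~ x, y].
Proof. by move=> Hx Hy; apply/subgroupM/subgroupJ => //; apply: subgroupV. Qed.

Lemma subgroupX x n : H x -> H (x ^+ n).
Proof.
by move=> Hx; elim: n => [|n IH]; [exact: subgroup1|rewrite expgS; exact: subgroupM].
Qed.

Lemma subgroup_mull x y : H x -> H (x * y) -> H y.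
Proof. by move=> Hx Hxy; rewrite -(mulKg x y); apply/subgroupM/Hxy/subgroupV. Qed.

Lemma subgroup_mulr x y : H y -> H (x * y) -> H x.
Proof. by move=> Hy Hxy; rewrite -(mulgK y x); apply/subgroupM/subgroupV. Qed.

End Closure.

Lemma subgroupI H K : is_subgroup H -> is_subgroup K -> is_subgroup (H `&` K).
Proof.
move=> /subgroupP[H1 HM HV] /subgroupP[K1 KM KV]; apply/subgroupP.
by split=> // [x y|x] [? ?]; [case=> ? ?|]; split; auto.
Qed.

Lemma generated_subgroup A : is_subgroup (generated A).
Proof.
apply/subgroupP; split=> [|x y gx gy|x gx] K [sK AK].
- exact: subgroup1.
- by apply: subgroupM; [|exact: gx|exact: gy].
- by apply: subgroupV; [|exact: gx].
Qed.

Lemma generated_sub A : A `<=` generated A.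
Proof. by move=> a Aa K [_]; apply. Qed.

Lemma generated_le A K : is_subgroup K -> A `<=` K -> generated A `<=` K.
Proof. by move=> sK AK x; apply. Qed.

(** In a torsion group inverses are positive powers. *)
Lemma torsion_subgroup G H : torsion G -> H `<=` G -> H 1 ->
  (forall x y, H x -> H y -> H (x * y)) -> is_subgroup H.
Proof.
move=> tG HG H1 HM; apply/subgroupP; split=> // x Hx.
have [[//|n] _ xn] := tG x (HG _ Hx).
suff -> : x^-1 = x ^+ n.
  by elim: n {xn} => [//|n IH]; rewrite expgS; apply: HM.
by apply: (mulgI x); rewrite mulgV -expgS.
Qed.

(** Finite index is handled through maps to a finite type whose fibres lie in
    cosets: intersections and towers lead to pairs of such maps, the normal
    core to finite functions. *)
Lemma finite_indexP G H : is_subgroup H -> finite_index G H <->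
  exists (I : finType) (f : gT -> I),
    forall x y, G x -> G y -> f x = f y -> H (x^-1 * y).
Proof.
move=> sH; split=> [/finite_seqP[s Es]|[I [f fP]]].
  exists 'I_(size s).+1, (fun x => inord (index (left_coset H x) s)) => x y Gx Gy.
  have sP z : G z -> left_coset H z \in s.
    by move=> Gz; have : [set` s] (left_coset H z) by rewrite -Es; exists z.
  move=> /(congr1 val); rewrite /= !inordK ?ltnS ?index_size// => eqI.
  have eqC : left_coset H x = left_coset H y.
    by rewrite -(nth_index set0 (sP _ Gx)) eqI nth_index// sP.
  have : left_coset H y y by exists 1; [exact: subgroup1|rewrite mulg1].
  by rewrite -eqC => -[h Hh <-]; rewrite mulKg.
pose F i := [set z | exists x, [/\ G x, f x = i & left_coset H x z]].
apply: (@sub_finite_set _ _ (F @` setT)); last exact: finite_image.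
move=> _ [x Gx <-]; exists (f x) => //; apply/seteqP; split=> [z|z xz]; last by exists x.
move=> [y [Gy fxy [h Hh <-]]]; exists (x^-1 * y * h); last by rewrite !mulgA mulgV mul1g.
by apply: (subgroupM sH) => //; apply: fP.
Qed.

(** An element x of G is recorded by the label f x of its coset of K together
    with the label of r^-1 * x, where r is the chosen element with label f x. *)
Lemma finite_index_trans G K H : is_subgroup G -> is_subgroup K -> is_subgroup H ->
  K `<=` G -> finite_index G K -> finite_index K H -> finite_index G H.
Proof.
move=> sG sK sH KG /finite_indexP-/(_ sK)[I [f fP]] /finite_indexP-/(_ sH)[J [h hP]].
have [r rP] : exists r : I -> gT, forall x, G x -> G (r (f x)) /\ f (r (f x)) = f x.
  have /choice[r rP] (i : I) : exists y, forall x, G x -> f x = i -> G y /\ f y = i.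
    by have [[x [Gx <-]]|nx] := pselect (exists x, G x /\ f x = i);
      [exists x|exists 1 => x Gx fx; case: nx; exists x].
  by exists r => x Gx; apply: rP Gx _.
apply/finite_indexP => //.
exists (I * J)%type, (fun x => (f x, h ((r (f x))^-1 * x))) => x y Gx Gy [fxy].
have [Grx frx] := rP x Gx; have [Gry fry] := rP y Gy.
move=> /hP; rewrite -fxy invgM invgK !mulgA mulgK; apply; apply: fP => //.
by rewrite fxy.
Qed.

Lemma finite_index_sub G G' H H' : is_subgroup H -> is_subgroup H' ->
  G' `<=` G -> H `<=` H' -> finite_index G H -> finite_index G' H'.
Proof.
move=> sH sH' GG HH /finite_indexP-/(_ sH)[I [f fP]]; apply/finite_indexP => //.
by exists I, f => x y Gx Gy /fP fxy; apply/HH/fxy; apply: GG.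
Qed.

Lemma finite_indexI G H K : is_subgroup H -> is_subgroup K ->
  finite_index G H -> finite_index G K -> finite_index G (H `&` K).
Proof.
move=> sH sK /finite_indexP-/(_ sH)[I [f fP]] /finite_indexP-/(_ sK)[J [h hP]].
apply/finite_indexP; first exact: subgroupI.
exists (I * J)%type, (fun x => (f x, h x)) => x y Gx Gy [fxy hxy].
by split; [exact: fP|exact: hP].
Qed.

Lemma finite_index_reps G H : is_subgroup G -> is_subgroup H -> finite_index G H ->
  exists2 R : set gT, finite_set R &
    R `<=` G /\ forall x, G x -> exists2 r, R r & H (r^-1 * x).
Proof.
move=> sG sH /finite_indexP-/(_ sH)[I [f fP]].
have /choice[r rP] (i : I) : exists y, G y /\ forall x, G x -> f x = i -> f y = i.
  have [[x [Gx fx]]|nx] := pselect (exists x, G x /\ f x = i); first by exists x.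
  by exists 1; split=> [|x Gx fx]; [exact: subgroup1|case: nx; exists x].
exists (r @` setT); first exact: finite_image.
split=> [_ [i _ <-]|x Gx]; first by case: (rP i).
by exists (r (f x)) => //; have [Gr /(_ x Gx erefl)] := rP (f x); apply: fP.
Qed.

Lemma infinite_pigeonhole G H A : is_subgroup H -> infinite_set A -> A `<=` G ->
  finite_index G H -> exists x y, [/\ A x, A y, x <> y & H (x^-1 * y)].
Proof.
move=> sH infA AG /finite_indexP-/(_ sH)[I [f fP]].
apply: contrapT => nE; apply: infA.
have [[a Aa]|nA] := pselect (exists a, A a); last first.
  by apply: (@sub_finite_set _ _ set0) => // x Ax; apply: nA; exists x.
have /choice[r rP] (i : I) : exists y, forall x, A x -> f x = i -> x = y.
  have [[y [Ay fy]]|nx] := pselect (exists x, A x /\ f x = i); last first.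
    by exists a => x Ax fx; case: nx; exists x.
  exists y => x Ax fx; apply: contrapT => nxy; apply: nE; exists x, y; split=> //.
  by apply: fP; [exact: AG|exact: AG|rewrite fx fy].
apply: (@sub_finite_set _ _ (r @` setT)); last exact: finite_image.
by move=> x Ax; exists (f x) => //; rewrite -(rP (f x) x).
Qed.

(** Two elements that send each of the finitely many coset representatives r
    of H into the same coset differ by an element whose conjugates by all r,
    hence by all of G, are in H. *)
Lemma normal_core G H : is_subgroup G -> is_subgroup H -> H `<=` G ->
  finite_index G H ->
  exists2 N, normal_subgroup G N & N `<=` H /\ finite_index G N.
Proof.
move=> sG sH HG fiH; pose N := [set x | G x /\ forall g, G g -> H (x ^ g)].
have sN : is_subgroup N.
  apply/subgroupP; split=> [|x y [Gx Nx] [Gy Ny]|x [Gx Nx]].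
  - by split=> [|g _]; rewrite ?conj1g; apply: subgroup1.
  - split; first exact: subgroupM.
    by move=> g Gg; rewrite conjMg; apply: subgroupM; auto.
  - split; first exact: subgroupV.
    by move=> g Gg; rewrite conjVg; apply: subgroupV; auto.
exists N.
  split=> // [x []//|g x Gg [Gx Nx]]; split; first exact: subgroupJ.
  by move=> k Gk; rewrite -conjgM; apply: Nx; apply: subgroupM.
split; first by move=> x [_ /(_ 1)]; rewrite conjg1; apply; apply: subgroup1.
have [R /finite_seqP[s ->] [RG RP]] := finite_index_reps sG sH fiH.
have [I [f fP]] := (finite_indexP G sH).1 fiH.
apply/finite_indexP => //.
exists {ffun seq_sub s -> I}, (fun x => [ffun r : seq_sub s => f (x * val r)]).
move=> x y Gx Gy /ffunP exy; have Gxy : G (x^-1 * y).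
  by apply: subgroupM => //; apply: subgroupV.
split=> // g Gg; have [r sr Hrg] := RP g Gg.
have := exy (SeqSub sr); rewrite !ffunE /= => /fP; have Gr := RG r sr.
rewrite invgM => /(_ (subgroupM sG Gx Gr) (subgroupM sG Gy Gr)) Hr.
rewrite -(mulVKg r g) conjgM; apply: subgroupJ => //.
by rewrite /conjg !mulgA in Hr *.
Qed.

(** Schreier's argument. Let T be finite with 1 in T and G = H T, let S consist
    of 1, the generators and their inverses, and let K be generated by the
    elements t s u^-1 of H with t, u in T and s in S. Then K T is stable under
    right multiplication by S, so it is G; and H is contained in K because H
    meets T inside K. *)
Lemma finite_index_fg G H : is_subgroup G -> is_subgroup H -> H `<=` G ->
  finitely_generated G -> finite_index G H -> finitely_generated H.
Proof.
move=> sG sH HG [A finA GA] fiH.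
have [R finR [RG RP]] := finite_index_reps sG sH fiH.
pose T := 1 |` [set x^-1 | x in R]; pose S := 1 |` (A `|` [set x^-1 | x in A]).
have AG : A `<=` G by rewrite GA; apply: generated_sub.
have SG : S `<=` G.
  move=> _ [->|[/AG//|[x /AG Gx <-]]]; first exact: subgroup1.
  exact: subgroupV.
have TG : T `<=` G.
  by move=> _ [->|[x /RG Gx <-]]; [exact: subgroup1|exact: subgroupV].
have TP x : G x -> exists2 t, T t & H (x * t^-1).
  move=> Gx; have [r Rr] := RP x^-1 (subgroupV sG Gx).
  rewrite -invgM => /(subgroupV sH); rewrite invgK => Hxr.
  by exists r^-1; [right; exists r|rewrite invgK].
pose B := H `&` ((fun p => p.1.1 * p.1.2 * p.2^-1) @` ((T `*` S) `*` T)).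
have sB := generated_subgroup B; exists B.
  apply: finite_setIr; apply: finite_image.
  by do !apply: finite_setX; rewrite ?finite_setU; do !split=> //; apply: finite_image.
have BH : generated B `<=` H by apply: generated_le => // x [].
apply/seteqP; split=> //.
pose KT := [set x | exists k t, [/\ generated B k, T t & x = k * t]].
have KTS x a : KT x -> S a -> KT (x * a).
  move=> [k [t [Bk Tt ->]]] Sa; have [u Tu Hu] := TP _ (subgroupM sG (TG _ Tt) (SG _ Sa)).
  exists (k * (t * a * u^-1)), u; split=> //; last by rewrite !mulgA mulgVK.
  apply: (subgroupM sB) => //; apply: generated_sub; split=> //.
  by exists ((t, a), u).
have T1 : T 1 by left.
have GKT : G `<=` KT.
  pose Q := [set g | forall x, KT x -> KT (x * g) /\ KT (x * g^-1)].
  suff GQ : G `<=` Q.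
    move=> g /GQ/(_ 1)[]; last by rewrite mul1g.
    by exists 1, 1; rewrite mulg1; split=> //; apply: subgroup1.
  rewrite GA; apply: generated_le => [|a Aa x KTx].
    apply/subgroupP; split=> [x|g h Qg Qh x KTx|g Qg x KTx].
    - by rewrite invg1 mulg1.
    - rewrite invgM !mulgA; split; first by have [/Qh[]] := Qg x KTx.
      by have [_ /Qg[]] := Qh x KTx.
    - by rewrite invgK; have [] := Qg x KTx.
  by split; apply: KTS => //; right; [left|right; exists a].
move=> h Hh; have [k [t [Bk Tt eh]]] := GKT h (HG h Hh).
rewrite eh; apply: (subgroupM sB) => //; apply: generated_sub; split.
  by apply: (subgroup_mull sH (BH _ Bk)); rewrite -eh.
by exists ((t, 1), 1) => /=; [do !split=> //; left|rewrite invg1 !mulg1].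
Qed.

(** Adjoin the generators to C one at a time. Since C contains the commutators,
    the products of C with the powers of a form a subgroup, in which C has
    finite index because a has finite order. *)
Lemma finite_index_commutators_seq (s : seq gT) G C :
  is_subgroup G -> torsion G -> is_subgroup C -> C `<=` G -> [set` s] `<=` G ->
  (forall x y, G x -> G y -> C [~ x, y]) ->
  (forall K, is_subgroup K -> C `<=` K -> [set` s] `<=` K -> G `<=` K) ->
  finite_index G C.
Proof.
move=> sG tG; elim: s C => [|a s IH] C sC CG aG CR gen.
  apply/finite_indexP => //; exists unit, (fun=> tt) => x y Gx Gy _.
  by apply: (gen C) => //; apply: subgroupM => //; apply: subgroupV.
have CJ x g : C x -> G g -> C (x ^ g).
  move=> Cx Gg; rewrite -(mulVKg x (x ^ g)); apply: subgroupM => //.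
  by apply: CR => //; apply: CG.
have Ga : G a by apply: aG; rewrite /= mem_head.
pose C' := [set x | exists k, C (x * a ^- k)].
have CC' : C `<=` C' by move=> x Cx; exists 0; rewrite expg0 invg1 mulg1.
have C'G : C' `<=` G.
  by move=> x [k /CG]; apply: subgroup_mulr => //; apply: subgroupV => //; apply: subgroupX.
have sC' : is_subgroup C'.
  apply: (torsion_subgroup tG C'G) => [|x y [k Cx] [l Cy]]; first exact: CC' _ (subgroup1 sC).
  exists (k + l); have Gk := subgroupV sG (subgroupX sG k Ga).
  have := subgroupM sC Cx (CJ _ _ Cy Gk).
  by rewrite conjgE invgK !mulgA mulgVK expgnDr invgM !mulgA.
have C'a : C' a by exists 1%N; rewrite expg1 mulgV; apply: subgroup1.
have fi1 : finite_index G C'.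
  apply: IH => // [x xs|x y Gx Gy|K sK C'K sK'].
  - by apply: aG; rewrite /= in_cons xs orbT.
  - exact/CC'/CR.
  - apply: gen => // x; first by move=> /CC'/C'K.
    by rewrite /= in_cons => /predU1P[->|/sK'//]; apply: C'K.
apply: (finite_index_trans sG sC' sC C'G fi1); apply/finite_indexP => //.
have [n n0 an] := tG a Ga.
have /choice[k kP] x : exists k, C' x -> C (x * a ^- k) /\ (k < n)%N.
  have [[k Cx]|nx] := pselect (C' x); last by exists 0.
  exists (k %% n) => _; split; last by rewrite ltn_mod.
  by move: Cx; rewrite {1}(divn_eq k n) expgnDr mulnC expgnA an expg1n mul1g.
exists 'I_n.+1, (fun x => inord (k x)) => x y /[dup] C'x /kP[Cx kx] /[dup] C'y /kP[Cy ky].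
move=> /(congr1 val) /=; rewrite !inordK; [move=> ek|exact: ltnW|exact: ltnW].
have := subgroupM sC (subgroupV sC Cx) Cy; rewrite ek !invgM invgK => C2.
suff -> : x^-1 * y = (a ^+ k y * x^-1 * (y * a ^- k y)) ^ (a ^+ k y).
  by apply: CJ => //; apply: subgroupX.
by rewrite conjgE !mulgA mulVg mul1g mulgVK.
Qed.

(** This is the finiteness of finitely generated torsion abelian groups, for G/C. *)
Lemma finite_index_commutators G C : is_subgroup G -> finitely_generated G ->
  torsion G -> is_subgroup C -> C `<=` G ->
  (forall x y, G x -> G y -> C [~ x, y]) -> finite_index G C.
Proof.
move=> sG [A /finite_seqP[s sA] GA] tG sC CG CR.
have AG : A `<=` G by rewrite GA; apply: generated_sub.
apply: (@finite_index_commutators_seq s) => //; first by rewrite -sA.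
by move=> K sK CK sK'; rewrite GA; apply: generated_le => //; rewrite sA.
Qed.

(** A subgroup containing K is determined by the labels of the cosets of K that
    it contains, and a proper one with the largest number of labels is
    maximal. *)
Lemma maximal_finite_index_above G K : is_subgroup G -> is_subgroup K ->
  K `<` G -> finite_index G K ->
  exists2 M, maximal_subgroup G M & K `<=` M /\ finite_index G M.
Proof.
move=> sG sK [KG nGK] fiK; have [I [f fP]] := (finite_indexP G sK).1 fiK.
pose ok n := `[< exists M, [/\ is_subgroup M, K `<=` M, M `<` G &
  #|[pred i | `[< exists2 x, M x & f x = i >]]| = n] >].
have ok_ex : exists n, ok n by eexists; apply/asboolP; exists K; split=> //.
have ok_le n : ok n -> (n <= #|I|)%N.
  by move=> /asboolP[M [_ _ _ <-]]; apply: max_card.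
case: (ex_maxnP ok_ex ok_le) => _ /asboolP[M [sM KM [MG nGM] <-]] maxM.
exists M; last by split=> //; exact: (finite_index_sub sK sM (fun _ => id) KM fiK).
split=> // L sL ML LG; have [GL|nGL] := pselect (G `<=` L).
  by right; apply/seteqP.
left; apply/seteqP; split=> // y Ly.
set A := [pred i | _] in maxM.
pose B := [pred i | `[< exists2 x, L x & f x = i >]].
have sAB : A \subset B.
  apply/fintype.subsetP => i; rewrite inE => -[x Mx fx]; rewrite inE.
  by exists x => //; apply: ML.
have BA : (#|B| <= #|A|)%N.
  by apply: maxM; apply/asboolP; exists L; split=> // x /KM/ML.
have eAB : A =i B by apply/subset_cardP/sAB/eqP; rewrite eqn_leq subset_leq_card.
have : f y \in A by rewrite eAB inE; exists y.
rewrite inE => -[x Mx fx].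
apply: (subgroup_mull sM (subgroupV sM Mx)); apply/KM/fP => //; first exact: MG.
exact: LG.
Qed.

(** Up to inversion the exponent is a natural number, so that integer powers are
    avoided. *)
Lemma mem_cyclic g h : generated [set g] h ->
  exists e, h = g ^+ e \/ h^-1 = g ^+ e.
Proof.
pose Q := [set h | exists i j, h = g ^+ i * g ^- j].
have comm (i j : nat) : commute (g ^+ i) (g ^- j) by apply: commuteV; apply: commuteX2.
have sQ : is_subgroup Q.
  apply/subgroupP; split=> [|_ _ [i [j ->]] [k [l ->]]|_ [i [j ->]]].
  - by exists 0%N, 0%N; rewrite expg0 mulgV.
  - exists (i + k)%N, (l + j)%N.
    by rewrite !expgnDr invgM !mulgA -[_ * g ^- j * _]mulgA -comm !mulgA.
  - by exists j, i; rewrite invgM invgK.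
have gQ : generated [set g] `<=` Q.
  by apply: generated_le => // _ ->; exists 1%N, 0%N; rewrite expg0 expg1 invg1 mulg1.
move=> /gQ[i [j ->]]; have [ij|ji] := leqP i j.
  exists (j - i)%N; right; rewrite invgM invgK.
  by rewrite -{1}(subnK ij) expgnDr mulgK.
by exists (i - j)%N; left; rewrite -{1}(subnK (ltnW ji)) expgnDr mulgK.
Qed.

Lemma finite_index_expg G L g :
  is_subgroup G -> is_subgroup L -> finite_index G L -> G g ->
  exists2 n, (0 < n)%N & L (g ^+ n).
Proof.
move=> sG sL /(finite_indexP G sL)[I [f fP]] Gg.
have [i [j [ij eij]]] : exists i j : 'I_(#|I|.+1), (i < j)%N /\ f (g ^+ i) = f (g ^+ j).
  apply: contrapT => nE.
  have inj : injective (fun i : 'I_(#|I|.+1) => f (g ^+ i)).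
    move=> i j eij; apply: ord_inj; case: (ltngtP i j) => // ij.
      by case: nE; exists i, j.
    by case: nE; exists j, i.
  by have := leq_card _ inj; rewrite card_ord ltnn.
exists (j - i)%N; first by rewrite subn_gt0.
rewrite -(mulKg (g ^+ i) (g ^+ (j - i))) -expgnDr subnKC; last exact: ltnW.
by apply: fP => //; exact: subgroupX.
Qed.

(** The identity [~ x * y, z] = [~ x, z] ^ y * [~ y, z] moves commutators with a
    fixed z from generators to products, at the price of a conjugation; this
    is why C has to be normalised. *)
Lemma commutators_generated A C : is_subgroup C ->
  (forall g c, generated A g -> C c -> C (c ^ g)) ->
  (forall a b, A a -> A b -> C [~ a, b]) ->
  forall x y, generated A x -> generated A y -> C [~ x, y].
Proof.
move=> sC nC CA; have sA := generated_subgroup A.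
have swap x y : C [~ x, y] -> C [~ y, x].
  by move=> /(subgroupV sC); rewrite invgR.
pose Q z := [set x | generated A x /\ C [~ x, z]].
have sQ z : generated A z -> is_subgroup (Q z).
  move=> Az; apply/subgroupP; split=> [|x y [Ax Qx] [Ay Qy]|x [Ax Qx]].
  - by rewrite /Q/= comm1g; split; apply: subgroup1.
  - split; first exact: (subgroupM sA).
    rewrite [X in C X](_ : _ = [~ x, z] ^ y * [~ y, z]).
      by apply: (subgroupM sC) => //; apply: nC.
    by rewrite !commgEl !conjgE !invgM !mulgA !mulgK.
  - split; first exact: (subgroupV sA).
    rewrite [X in C X](_ : _ = ([~ x, z] ^ x^-1)^-1).
      by apply: (subgroupV sC); apply: nC => //; apply: (subgroupV sA).
    by rewrite !commgEl !conjgE !invgM !invgK !mulgA mulgK.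
have QA b : A b -> generated A `<=` Q b.
  move=> Ab; apply: generated_le; first by apply: sQ; apply: generated_sub.
  by move=> a Aa; split; [exact: generated_sub|exact: CA].
move=> x y Ax Ay; apply: (swap).
suff : generated A `<=` Q x by move=> /(_ y Ay)[].
apply: generated_le; first exact: sQ.
by move=> b Ab; split; [exact: generated_sub|apply: (swap); case: (QA b Ab x Ax)].
Qed.

(** The inverse of g appears in the hypothesis because a subgroup mapped into
    itself by a conjugation need not be mapped onto itself. *)
Lemma generated_conj A E :
  (forall g e, A g -> E e -> generated E (e ^ g) /\ generated E (e ^ g^-1)) ->
  forall g c, generated A g -> generated E c -> generated E (c ^ g).
Proof.
move=> nE g c Ag; move: c.
have sE := generated_subgroup E.
have preim k : is_subgroup [set c | generated E (c ^ k)].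
  apply/subgroupP; split=> [|x y Cx Cy|x Cx] /=.
  - by rewrite conj1g; apply: (subgroup1 sE).
  - by rewrite conjMg; apply: (subgroupM sE).
  - by rewrite conjVg; apply: (subgroupV sE).
pose Q := [set g | forall c, generated E c ->
  generated E (c ^ g) /\ generated E (c ^ g^-1)].
suff AQ : generated A `<=` Q by move=> c /(AQ g Ag)[].
apply: generated_le => [|a Aa c Ec].
  apply/subgroupP; split=> [c|x y Qx Qy c Ec|x Qx c Ec].
  - by rewrite invg1 conjg1.
  - rewrite invgM !conjgM; split; first by have [/Qy[]] := Qx c Ec.
    by have [_ /Qx[]] := Qy c Ec.
  - by rewrite invgK; have [] := Qx c Ec.
by split; move: c Ec; apply: generated_le => [|e Ee];
  by [exact: preim|have [] := nE a e Aa Ee].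
Qed.

Lemma mul_normal_subgroup G H N : is_subgroup H -> H `<=` G ->
  normal_subgroup G N ->
  is_subgroup [set x | exists h n, [/\ H h, N n & x = h * n]].
Proof.
move=> sH HG [sN NG nN]; apply/subgroupP.
split=> [|_ _ [h [n [Hh Nn ->]]] [k [m [Hk Nm ->]]]|_ [h [n [Hh Nn ->]]]].
- by exists 1, 1; rewrite mulg1; split=> //; apply: subgroup1.
- exists (h * k), (n ^ k * m); split; first exact: (subgroupM sH).
    by apply: (subgroupM sN) => //; apply: nN => //; apply: HG.
  by rewrite conjgE !mulgA mulgK.
- have HhV := subgroupV sH Hh; exists h^-1, (n^-1 ^ h^-1); split=> //.
    by apply: nN; [exact: HG|exact: (subgroupV sN)].
  by rewrite conjgE !invgM invgK mulKg.
Qed.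

End Groups.

(** * Maximal subgroups of finite index *)

Section PGroups.
Variable gT : groupType.
Implicit Types (G H M : set gT) (x y g : gT).

Lemma coset_finType G H : is_subgroup G -> is_subgroup H -> finite_index G H ->
  exists (I : finType) (q : gT -> I),
    (forall c, exists2 x, G x & q x = c) /\
    (forall x y, G x -> G y -> q x = q y <-> H (x^-1 * y)).
Proof.
move=> sG sH /finite_seqP[s Es].
have sP x : G x -> left_coset H x \in s.
  by move=> Gx; have : [set` s] (left_coset H x) by rewrite -Es; exists x.
exists (seq_sub s), (fun x => insubd (SeqSub (sP 1 (subgroup1 sG))) (left_coset H x)).
split=> [c|x y Gx Gy].
  have : [set` s] (val c) by apply: valP.
  by rewrite -Es => -[x Gx xc]; exists x => //; apply/val_inj; rewrite val_insubd sP.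
split=> [/(congr1 val)|Hxy]; last first.
  congr insubd; apply/seteqP; split=> _ [h Hh <-].
    exists ((x^-1 * y)^-1 * h); last by rewrite invgM invgK !mulgA mulgV mul1g.
    by apply: (subgroupM sH) => //; apply: subgroupV.
  exists (x^-1 * y * h); last by rewrite !mulgA mulgV mul1g.
  exact: (subgroupM sH).
rewrite !val_insubd !sP// => exy.
have : left_coset H y y by exists 1; [exact: subgroup1|rewrite mulg1].
by rewrite -exy => -[h Hh <-]; rewrite mulKg.
Qed.

(** The action of G on the cosets of M has as image a finite p-group P, in which
    M corresponds to a point stabiliser S. Maximality of M makes S maximal in
    P, hence normal of index p. *)
Lemma p_group_maximal_commutator p G M : prime p -> is_subgroup G ->
  p_group p G -> maximal_subgroup G M -> finite_index G M ->
  forall x y, G x -> G y -> M [~ x, y].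
Proof.
move=> p_pr sG pG [sM [MG nGM] maxM] fiM.
have [I [q [qsurj qP]]] := coset_finType sG sM fiM.
have G1 := subgroup1 sG.
have MP g : G g -> M g <-> q g = q 1.
  by move=> Gg; rewrite -[M g]/(M (id g)) (rwP eqP) eq_sym -(rwP eqP) qP// invg1 mul1g.
(* The image of G in the permutations of its cosets is described by this
   relation; it reverses products, since permutations act on the right. *)
pose acts g (s : {perm I}) := forall x, G x -> q (g * x) = s (q x).
have actsM g h s t : G h -> acts g s -> acts h t -> acts (g * h) (t * s).
  by move=> Gh gs ht x Gx; rewrite permM -ht// -gs ?mulgA//; apply: subgroupM.
have acts1 : acts 1 1 by move=> x Gx; rewrite mul1g perm1.
have actsV g s : G g -> acts g s -> acts g^-1 s^-1.
  move=> Gg gs x Gx; apply: (@perm_inj _ s); rewrite permKV -gs ?mulVKg//.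
  by apply: subgroupM => //; apply: subgroupV.
have actsX g s n : G g -> acts g s -> acts (g ^+ n) (s ^+ n).
  move=> Gg gs; elim: n => [//|n IH]; rewrite expgSr expgS.
  exact: actsM.
have acts_inj g s t : acts g s -> acts g t -> s = t.
  by move=> gs gt; apply/permP => c; have [x Gx <-] := qsurj c; rewrite -gs// gt.
have acts_ex g : G g -> exists s, acts g s.
  move=> Gg; have /choice[r rP] (c : I) : exists x, G x /\ q x = c.
    by have [x Gx qx] := qsurj c; exists x.
  have qE x : G x -> q (g * x) = q (g * r (q x)).
    have [Gr qr] := rP (q x); move=> Gx; apply/qP; try exact: subgroupM.
    by rewrite invgM !mulgA mulgVK; apply/qP.
  have inj : injective (fun c => q (g * r c)).
    move=> c e; have [Gc qc] := rP c; have [Ge qe] := rP e.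
    move=> /(qP _ _ (subgroupM sG Gg Gc) (subgroupM sG Gg Ge)).
    by rewrite invgM !mulgA mulgVK => /(qP _ _ Gc Ge); rewrite qc qe.
  by exists (perm inj) => x Gx; rewrite permE; apply: qE.
pose P := [set s : {perm I} | `[< exists2 g, G g & acts g s >]]%SET.
have gP : group_set P.
  apply/group_setP; split=> [|s t]; rewrite !inE; first by exists 1.
  move=> [g Gg gs] [h Gh ht]; exists (h * g); first exact: subgroupM.
  exact: actsM.
pose S := [set s in P | s (q 1) == q 1]%SET.
have gS : group_set S.
  apply/group_setP; split=> [|s t]; first by rewrite inE (@group1 _ (Group gP)) perm1 eqxx.
  rewrite ![_ \in S]inE => /andP[Ps /eqP s1] /andP[Pt /eqP t1].
  by rewrite (groupM (G := Group gP)) //= permM s1 t1.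
have acts_S g s : G g -> acts g s -> s \in S <-> M g.
  move=> Gg gs; have Ps : s \in P by rewrite !inE; exists g.
  by rewrite inE Ps/= -gs// mulg1 MP//; split=> [/eqP|->].
have maxS : maximal (Group gS) (Group gP).
  apply/maxgroupP; split=> [|K].
    apply/properP; split; first by apply/fintype.subsetP => s; rewrite inE => /andP[].
    have [g Gg nMg] : exists2 g, G g & ~ M g.
      by apply: contrapT => nE; apply: nGM => g Gg; apply: contrapT => nMg; apply: nE; exists g.
    have [s gs] := acts_ex g Gg; exists s; first by rewrite !inE; exists g.
    by apply/negP => /(acts_S g s Gg gs).
  move=> /properP[KP [t Pt Kt]] SK; apply/eqP; rewrite finset.eqEsubset SK andbT.
  pose K' := [set g | G g /\ exists2 s, s \in K & acts g s].
  have sK' : is_subgroup K'.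
    apply/subgroupP; split=> [|g h [Gg [s Ks gs]] [Gh [u Ku hu]]|g [Gg [s Ks gs]]].
    - by split=> //; exists 1.
    - split; first exact: subgroupM.
      by exists (u * s); [exact: groupM|exact: actsM].
    - split; first exact: subgroupV.
      by exists s^-1; [rewrite groupV|exact: actsV].
  have MK' : M `<=` K'.
    move=> g Mg; have Gg := MG g Mg; split=> //; have [s gs] := acts_ex g Gg.
    by exists s => //; apply: (fintype.subsetP SK); apply/(acts_S g).
  have [|K'M|K'G] := maxM K' sK' MK'; first by move=> g [].
    apply/fintype.subsetP => s Ks; have [g Gg gs] : exists2 g, G g & acts g s.
      by have := fintype.subsetP KP s Ks; rewrite !inE.
    apply: (acts_S g s Gg gs).2.
    by rewrite -K'M; split=> //; exists s.
  move: Pt; rewrite !inE => -[g Gg gt]; have : K' g by rewrite K'G.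
  by move=> [_ [s Ks gs]]; rewrite (acts_inj _ _ _ gt gs) Ks in Kt.
have pP : p.-group (Group gP).
  apply/pgroupP => r r_pr /(Cauchy r_pr)[s]; rewrite !inE => -[g Gg gs] os.
  have [k gk] := pG g Gg; have : s ^+ (p ^ k) = 1.
    by apply: (acts_inj 1) => //; rewrite -gk; apply: actsX.
  move=> /eqP; rewrite -order_dvdn os Euclid_dvdX// => /andP[+ _].
  by rewrite dvdn_prime2// inE.
have nS := p_maximal_normal pP maxS.
have abS : abelian (Group gP / Group gS).
  apply: cyclic_abelian; apply: prime_cyclic.
  by rewrite card_quotient ?normal_norm// (p_maximal_index pP maxS).
have derS := der1_min (normal_norm nS) abS.
move=> x y Gx Gy; have [s xs] := acts_ex x Gx; have [t yt] := acts_ex y Gy.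
have GR : G [~ x, y] by apply: subgroupR.
have actR : acts [~ x, y] [~ t^-1, s^-1].
  have -> : [~ x, y] = x^-1 * y^-1 * (x * y) by rewrite commgEl conjgE mulgA.
  have -> : [~ t^-1, s^-1] = t * s * (t^-1 * s^-1).
    by rewrite commgEl conjgE !invgK mulgA.
  apply: (actsM); [exact: subgroupM| |exact: actsM].
  by apply: (actsM); [exact: subgroupV|exact: actsV|exact: actsV].
apply/(acts_S _ _ GR actR); apply: (fintype.subsetP derS).
by apply: mem_commg; rewrite groupV !inE; [exists y|exists x].
Qed.

End PGroups.

Section Frattini.
Variable gT : groupType.
Implicit Types (A C G H K L M N : set gT) (x y g : gT).

Lemma maximal_conj G M k : is_subgroup G -> G k -> maximal_subgroup G M ->
  finite_index G M ->
  maximal_subgroup G [set x | M (x ^ k)] /\ finite_index G [set x | M (x ^ k)].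
Proof.
move=> sG Gk [sM [MG nGM] maxM] fiM.
have sJ K j : is_subgroup K -> is_subgroup [set x | K (x ^ j)].
  move=> sK; apply/subgroupP; split=> [|x y Kx Ky|x Kx] /=.
  - by rewrite conj1g; apply: subgroup1.
  - by rewrite conjMg; apply: (subgroupM sK).
  - by rewrite conjVg; apply: (subgroupV sK).
have GkV : G k^-1 by apply: subgroupV.
have GJ x j : G j -> G (x ^ j) -> G x.
  by move=> Gj Gx; rewrite -(conjgK j x); apply: subgroupJ => //; apply: subgroupV.
split.
  split; first exact: sJ.
    split=> [x /MG|GM]; first exact: GJ.
    apply: nGM => x Gx; rewrite -(conjgKV k x); apply: (GM (x ^ k^-1)).
    exact: subgroupJ.
  move=> K sK MK KG; have [||x|KM|KG'] := maxM [set x | K (x ^ k^-1)].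
  - exact: sJ.
  - by move=> x Mx; apply: MK; rewrite /= conjgKV.
  - by move=> /KG; apply: GJ.
  - left; apply/seteqP; split=> x; last exact: MK.
    by move=> Kx; rewrite /= -KM /= conjgK.
  - right; apply/seteqP; split=> // x Gx.
    have : G (x ^ k) by apply: subgroupJ.
    by rewrite -KG' /= conjgK.
have [I [f fP]] := (finite_indexP G sM).1 fiM; apply/finite_indexP; first exact: sJ.
exists I, (fun x => f (x ^ k)) => x y Gx Gy /fP.
by rewrite /= conjMg conjVg; apply; apply: subgroupJ.
Qed.

Lemma finite_index_Frattini_normal G : is_subgroup G ->
  normal_subgroup G (finite_index_Frattini G).
Proof.
move=> sG; split=> [|x []//|g x Gg [Gx Fx]].
- apply/subgroupP; split=> [|x y [Gx Fx] [Gy Fy]|x [Gx Fx]].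
  + split; first exact: subgroup1.
    by move=> M [[sM _ _] _]; apply: subgroup1.
  + split; first exact: subgroupM.
    by move=> M mM; have [[sM _ _] _] := mM; apply: (subgroupM sM); [exact: Fx|exact: Fy].
  + split; first exact: subgroupV.
    by move=> M mM; have [[sM _ _] _] := mM; apply: (subgroupV sM); exact: Fx.
- split; first exact: subgroupJ.
  move=> M [mM fiM]; exact: (Fx [set x | M (x ^ g)] (maximal_conj sG Gg mM fiM)).
Qed.

(** A proper subgroup of finite index containing H would lie in a maximal one N;
    as N also contains the intersection F of all of these, it would contain H F,
    which contains the generators of G. So H N = G for N normal of finite index,
    and the normal core reduces arbitrary L to this case. *)
Lemma maximal_infinite_index_dense G M : is_subgroup G -> finitely_generated G ->
  finite_index G (finite_index_Frattini G) -> maximal_subgroup G M ->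
  ~ finite_index G M ->
  exists H, [/\ is_subgroup H, H `<=` M, finitely_generated H &
    forall L, is_subgroup L -> finite_index G L ->
      forall g, G g -> exists h l, [/\ H h, G l, L l & g = h * l]].
Proof.
move=> sG [A finA GA] fiF [sM [MG nGM] maxM] nfi.
set F := finite_index_Frattini G in fiF.
have [sF FG nF] : normal_subgroup G F := finite_index_Frattini_normal sG.
have prodG H N : is_subgroup H -> H `<=` G -> normal_subgroup G N ->
    [set x | exists h n, [/\ H h, N n & x = h * n]] `<=` G.
  by move=> sH HG [_ NG _] _ [h [n [Hh Nn ->]]]; apply: (subgroupM sG); auto.
(* Otherwise F would be contained in M, and M would have finite index. *)
have MF : G `<=` [set x | exists h n, [/\ M h, F n & x = h * n]].
  have nFG := finite_index_Frattini_normal sG.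
  have [||eM|->//] := maxM _ (mul_normal_subgroup sM MG nFG).
  - by move=> m Mm; exists m, 1; rewrite mulg1; split=> //; apply: subgroup1.
  - exact: prodG.
  exfalso; apply: nfi; apply: (finite_index_sub sF sM (fun _ => id) _ fiF).
  move=> x Fx; rewrite -eM; exists 1, x; rewrite mul1g; split=> //.
  exact: subgroup1.
have AG : A `<=` G by rewrite GA; apply: generated_sub.
have /choice[m mP] x : exists m, A x -> M m /\ F (m^-1 * x).
  have [Ax|nA] := pselect (A x); last by exists 1.
  have [m [n [Mm Fn ->]]] := MF x (AG x Ax).
  by exists m; rewrite mulKg.
pose H := generated (m @` A); have sH : is_subgroup H := generated_subgroup _.
have HM : H `<=` M by apply: generated_le => // _ [x Ax <-]; case: (mP x Ax).
have HG : H `<=` G by move=> x /HM/MG.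
exists H; split=> //; first by exists (m @` A) => //; apply: finite_image.
have Hmax K : is_subgroup K -> finite_index G K -> K `<=` G -> H `<=` K -> G `<=` K.
  move=> sK fiK KG HK; apply: contrapT => nGK.
  have [N mN [KN fiN]] := maximal_finite_index_above sG sK (conj KG nGK) fiK.
  have [sN [NG nGN] _] := mN; apply: nGN; rewrite GA; apply: generated_le => // x Ax.
  have [Mm [_ Fm]] := mP x Ax; rewrite -(mulVKg (m x) x); apply: (subgroupM sN).
    by apply/KN/HK; apply: generated_sub; exists x.
  exact: Fm.
move=> L sL fiL g Gg.
have sLG := subgroupI sL sG.
have [||N nN [NL fiN]] := normal_core sG sLG.
- by move=> x [].
- apply: finite_indexI => //; apply/finite_indexP => //.
  exists unit, (fun=> tt) => x y Gx Gy _.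
  by apply: subgroupM => //; apply: subgroupV.
have [sN NG _] := nN; have sHN := mul_normal_subgroup sH HG nN.
have [||h [l [Hh Nl ->]]] := Hmax _ sHN _ (prodG H N sH HG nN) _ g Gg.
- apply: (finite_index_sub sN sHN (fun _ => id) _ fiN) => x Nx.
  by exists 1, x; rewrite mul1g; split=> //; apply: subgroup1.
- by move=> h Hh; exists h, 1; rewrite mulg1; split=> //; apply: subgroup1.
by have [Ll Gl] := NL l Nl; exists h, l.
Qed.

End Frattini.

(** * Automorphisms supported below a vertex *)

Section Words.
Variable T : eqType.
Implicit Types u v w : seq T.

Lemma prefix_eq_size u v w :
  prefix u w -> prefix v w -> size u = size v -> u = v.
Proof. by rewrite !prefixE => /eqP uw /eqP vw e; rewrite -uw e. Qed.

Lemma prefix_size_eq u v : prefix u v -> (size v <= size u)%N -> u = v.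
Proof. by rewrite prefixE => /eqP uv vu; rewrite -uv take_oversize. Qed.

End Words.

Section TreeAut.
Variable d : nat.
Implicit Types (u v w x y z : vertex d) (g h k l a b r : tree_aut d).
Implicit Types (G H K L : set (tree_aut d)).

Lemma tree_autME g h v : (g * h) v = g (h v). Proof. by []. Qed.
Lemma tree_aut1E v : (1 : tree_aut d) v = v. Proof. by []. Qed.
Lemma tree_autK g : cancel g g^-1. Proof. exact: tree_invK. Qed.
Lemma tree_autVK g : cancel g^-1 g. Proof. exact: tree_invKV. Qed.

Lemma tree_autV_fix g v : g v = v -> g^-1 v = v.
Proof. by move=> gv; rewrite -{1}gv tree_autK. Qed.

Lemma tree_autX_fix g v n : g v = v -> (g ^+ n) v = v.
Proof. by move=> gv; elim: n => [//|n IH]; rewrite expgS tree_autME IH. Qed.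

Lemma prefix_tree_aut g v w : prefix (g v) (g w) = prefix v w.
Proof.
have sub k u z : prefix u z -> prefix (k u) (k z).
  by move=> /prefixP[s ->]; rewrite tree_aut_cat prefix_prefix.
by apply/idP/idP => [/(sub g^-1)|]; [rewrite !tree_autK|exact: sub].
Qed.

Lemma fix_prefix g v w : g w = w -> prefix v w -> g v = v.
Proof.
move=> gw vw; apply: (@prefix_eq_size _ _ _ w) => //; last exact: size_tree_aut.
by rewrite -gw prefix_tree_aut.
Qed.

Lemma neq1_moved g : g <> 1 -> exists y, g y <> y.
Proof.
move=> g1; apply: contrapT => nE; apply: g1; apply: tree_autP => y.
by apply: contrapT => gy; apply: nE; exists y.
Qed.

(** Equality of restrictions to the subtree at v. For g and h fixing v it is
    equality of sections at v, but it can be combined with multiplication in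
    the whole group. *)
Definition agree v g h := forall w, prefix v w -> g w = h w.

Lemma agree_root v g h : agree v g h -> g v = h v.
Proof. by apply; apply: prefix_refl. Qed.

Lemma agree_sym v g h : agree v g h -> agree v h g.
Proof. by move=> gh w /gh. Qed.

Lemma agree_trans v g h k : agree v g h -> agree v h k -> agree v g k.
Proof. by move=> gh hk w vw; rewrite gh// hk. Qed.

Lemma agree_prefix v w g h : prefix v w -> agree v g h -> agree w g h.
Proof. by move=> vw gh u /(prefix_trans vw)/gh. Qed.

Lemma agreeM v g g' h h' : g' v = v ->
  agree v g h -> agree v g' h' -> agree v (g * g') (h * h').
Proof.
move=> g'v gh gh' w vw; rewrite !tree_autME -gh'// gh//.
by rewrite -g'v prefix_tree_aut.
Qed.

Lemma agreeV v g h : g v = v -> agree v g h -> agree v g^-1 h^-1.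
Proof.
move=> gv gh w vw; apply: (@tree_aut_inj _ h); rewrite tree_autVK -gh ?tree_autVK//.
by rewrite -(tree_autV_fix gv) prefix_tree_aut.
Qed.

Lemma agreeX v g h n : g v = v -> agree v g h -> agree v (g ^+ n) (h ^+ n).
Proof.
move=> gv gh; elim: n => [//|n IH]; rewrite !expgS.
by apply: agreeM => //; apply: tree_autX_fix.
Qed.

Lemma fixM v g h : g v = v -> h v = v -> (g * h) v = v.
Proof. by move=> gv hv; rewrite tree_autME hv. Qed.

Lemma fixJ v g h : g v = v -> h v = v -> (g ^ h) v = v.
Proof. by move=> gv hv; do !apply: fixM => //; apply: tree_autV_fix. Qed.

Lemma fixR v g h : g v = v -> h v = v -> [~ g, h] v = v.
Proof. by move=> gv hv; apply: fixM; [exact: tree_autV_fix|exact: fixJ]. Qed.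

Lemma agreeR v g g' h h' : g v = v -> g' v = v ->
  agree v g h -> agree v g' h' -> agree v [~ g, g'] [~ h, h'].
Proof.
move=> gv gv' gh gh'; apply: agreeM; [exact: fixJ|exact: agreeV|].
apply: agreeM; [exact: fixM|exact: agreeV|exact: agreeM].
Qed.

Lemma Rist_subgroup G v : is_subgroup G -> is_subgroup (Rist G v).
Proof.
move=> sG; apply/subgroupP; split=> [|g h [Gg gv] [Gh hv]|g [Gg gv]].
- by split=> //; apply: subgroup1.
- split; first exact: subgroupM.
  by move=> w vw; rewrite tree_autME hv// gv.
- by split=> [|w vw]; [exact: subgroupV|rewrite tree_autV_fix// gv].
Qed.

Lemma Rist_le G v w : prefix v w -> Rist G w `<=` Rist G v.
Proof.
move=> vw g [Gg gw]; split=> // u vu; apply: gw.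
by apply: contra vu; apply: prefix_trans.
Qed.

Lemma Rist_moved G v g y : Rist G v g -> g y <> y -> prefix v y.
Proof. by move=> [_ gv] gy; apply/negPn/negP => /gv. Qed.

Lemma Rist_prefix G v g w : Rist G v g -> prefix v (g w) = prefix v w.
Proof.
move=> [_ gv]; apply/idP/idP; apply: contraTT => vw; first by rewrite gv.
suff -> : w = g w by [].
by apply: (@tree_aut_inj _ g); rewrite [RHS]gv.
Qed.

Lemma Rist_fix G v g w : Rist G v g -> (size w <= size v)%N -> g w = w.
Proof.
move=> Rg wv; have [vw|vw] := boolP (prefix v w); last by case: Rg => _; apply.
rewrite -(prefix_size_eq vw wv); apply/esym/prefix_size_eq; rewrite ?size_tree_aut//.
by rewrite (Rist_prefix _ Rg) prefix_refl.
Qed.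

Lemma RistJ G v g k : is_subgroup G -> Rist G v g -> G k ->
  Rist G (k^-1 v) (g ^ k).
Proof.
move=> sG [Gg gv] Gk; split; first exact: subgroupJ.
move=> w vw; rewrite !tree_autME gv ?tree_autK//.
by rewrite -(tree_autVK k v) prefix_tree_aut.
Qed.

(** An automorphism supported in T_v commutes with one that is trivial on T_v. *)
Lemma Rist_commute G v g h : Rist G v g -> agree v h 1 -> commute g h.
Proof.
move=> Rg hv; apply: tree_autP => w; rewrite !tree_autME.
have [vw|vw] := boolP (prefix v w).
  by rewrite !hv ?tree_aut1E// (Rist_prefix _ Rg).
have [_ gv] := Rg; rewrite [g w]gv// gv//; apply: contra vw => vhw.
suff -> : w = h w by [].
by apply: (@tree_aut_inj _ h); rewrite [RHS]hv.
Qed.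

Lemma Rist_trivial_off G v w g : Rist G v g -> size v = size w -> v <> w ->
  agree w g 1.
Proof.
move=> [_ gv] vw nvw u wu; apply: gv; apply/negP => vu; apply: nvw.
exact: prefix_eq_size vu wu vw.
Qed.

(** Here [~ l, a] = (a^-1 ^ l) * a, and the first factor is supported in the
    subtree at l^-1 y, which is disjoint from the support of b. *)
Lemma commg_Rist G l a b y : is_subgroup G -> G l -> l y <> y ->
  Rist G y a -> Rist G y b -> [~ [~ l, a], b] = [~ a, b].
Proof.
move=> sG Gl ly Ra Rb; set p := (a^-1) ^ l.
have Rp : Rist G (l^-1 y) p by apply: RistJ => //; apply: subgroupV => //; apply: Rist_subgroup.
have /conjg_fixP pb : [~ p, b] == 1.
  apply/commgP; apply/commute_sym; apply: (Rist_commute Rb).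
  apply: (Rist_trivial_off Rp); first by rewrite size_tree_aut.
  by move=> /(congr1 l); rewrite tree_autVK => /esym.
have -> : [~ l, a] = p * a by rewrite commgEl conjgE /p conjgE !mulgA.
by rewrite !commgEl conjMg pb invgM -mulgA mulKg.
Qed.

(** The conjugate b ^ a is supported in the subtree at a^-1 y, so it is not b. *)
Lemma commg_Rist_neq1 G a b y : is_subgroup G -> G a -> a y <> y -> Rist G y b ->
  b <> 1 -> [~ a, b] <> 1.
Proof.
move=> sG Ga ay Rb b1 /eqP/commgP/commute_sym/commgP/conjg_fixP bJ.
have [z bz] := neq1_moved b1; have yz := Rist_moved Rb bz.
have Rb' := RistJ sG Rb Ga; rewrite bJ in Rb'.
apply: bz; rewrite (Rist_trivial_off Rb' _ _ yz) ?size_tree_aut//.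
by move=> /(congr1 a); rewrite tree_autVK => /esym.
Qed.

End TreeAut.

(** * Level stabilisers and transversals *)

Section Levels.
Variable d : nat.
Implicit Types (u v w x y z : vertex d) (g h k l a b r : tree_aut d).
Implicit Types (G H K L : set (tree_aut d)) (V X : set (vertex d)).

Definition level n : set (vertex d) := [set v | size v = n].

Lemma Stab_subgroup G V : is_subgroup G -> is_subgroup (Stab G V).
Proof.
move=> sG; apply/subgroupP; split=> [|g h [Gg gV] [Gh hV]|g [Gg gV]].
- by split=> //; apply: subgroup1.
- by split=> [|v Vv]; [exact: subgroupM|rewrite tree_autME hV// gV].
- by split=> [|v Vv]; [exact: subgroupV|rewrite tree_autV_fix// gV].
Qed.

Lemma Stab_sub G V : Stab G V `<=` G. Proof. by move=> g []. Qed.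

Lemma Stab_le G H V X : G `<=` H -> X `<=` V -> Stab G V `<=` Stab H X.
Proof. by move=> GH XV g [/GH Hg gV]; split=> // v /XV/gV. Qed.

Lemma Stab_level_finite_index G n : is_subgroup G ->
  finite_index G (Stab G (level n)).
Proof.
move=> sG; apply/finite_indexP; first exact: Stab_subgroup.
exists {ffun n.-tuple 'I_d -> n.-tuple 'I_d}.
exists (fun g => [ffun t : n.-tuple 'I_d => insubd t (g (val t))]) => g h Gg Gh.
move=> /ffunP egh; split=> [|v vn]; first by apply: subgroupM => //; apply: subgroupV.
have : g v = h v.
  have := egh (Tuple (introT eqP vn)); rewrite !ffunE => /(congr1 val).
  by rewrite !val_insubd !size_tree_aut /= vn eqxx.
by rewrite tree_autME => <-; rewrite tree_autK.
Qed.

(** Every word extends to a longer one, whose image determines that of its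
    prefixes; if there is no letter, the only word is the root. *)
Lemma Stab_level_le G m n : (m <= n)%N -> Stab G (level n) `<=` Stab G (level m).
Proof.
move=> mn g [Gg gn]; split=> // v vm.
have [[i _]|nI] := pselect (exists i : 'I_d, True); last first.
  have v0 : v = [::] by case: v {vm} => // i; case: nI; exists i.
  by rewrite v0 tree_fun_root.
apply: (@fix_prefix _ _ _ (v ++ nseq (n - m) i)); last exact: prefix_prefix.
by apply: gn; rewrite /level/= size_cat vm size_nseq subnKC.
Qed.

Lemma agree_levelP (n : nat) g h :
  (forall w, size w = n -> agree w g h) -> (0 < d)%N -> g = h.
Proof.
move=> gh d0; apply: tree_autP => v; set i := Ordinal d0.
pose w := v ++ nseq n i.
have : g w = h w.
  apply: (gh (take n w)); last exact: prefix_take.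
  by rewrite size_takel// size_cat size_nseq leq_addl.
move=> e; apply: (@prefix_eq_size _ _ _ (g w)); rewrite ?size_tree_aut//.
  by rewrite prefix_tree_aut prefix_prefix.
by rewrite e prefix_tree_aut prefix_prefix.
Qed.

(** This is Koenig's lemma. Call v big if it has, at every depth, a descendant
    without a prefix in X. If the root is big, then big vertices have big
    children and one obtains a ray avoiding X. Once every word of length n has
    a prefix in X, no element of X is longer, as a ray through it would meet X
    twice. *)
Lemma transversal_bounded X : (0 < d)%N -> transversal X ->
  exists n, (forall v, X v -> (size v <= n)%N) /\
            (forall w, size w = n -> exists2 v, X v & prefix v w).
Proof.
move=> d0 tX; set i0 := Ordinal d0.
pose bad w := forall v, X v -> ~~ prefix v w.
have bad_prefix u w : prefix u w -> bad w -> bad u.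
  by move=> uw bw v Xv; apply: contra (bw v Xv) => /prefix_trans; apply.
have [n nP] : exists n, forall w, size w = n -> exists2 v, X v & prefix v w.
  apply: contrapT => nE.
  pose big v := forall m, exists2 u, size u = m & bad (v ++ u).
  have big0 : big [::].
    move=> m; apply: contrapT => nm; apply: nE; exists m => w wm.
    apply: contrapT => nX; apply: nm; exists w => // v Xv.
    by apply/negP => vw; apply: nX; exists v.
  have /choice[next nextP] v : exists i, big v -> big (rcons v i).
    have [bv|nbv] := pselect (big v); last by exists i0.
    apply: contrapT => nbig.
    have /choice[m mP] (i : 'I_d) :
        exists m, forall u, size u = m -> ~ bad (rcons v i ++ u).
      apply: contrapT => nm; apply: nbig; exists i => _ m.
      by apply: contrapT => nu; apply: nm; exists m => u um bu; apply: nu; exists u.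
    have [[//|i u] [su] bu] := bv (\max_i m i).+1.
    apply: (mP i (take (m i) u)); first by rewrite size_takel// su leq_bigmax.
    apply: bad_prefix bu; rewrite -cat_rcons; apply/prefixP.
    by exists (drop (m i) u); rewrite -catA cat_take_drop.
  pose r n := iter n (fun v => rcons v (next v)) [::].
  have rbig n : big (r n) by elim: n => [//|n IH]; apply: nextP.
  have [|v [[Xv [n rn]] _]] := tX r; first by split=> // n; exists (next (r n)).
  have [[|//] _] := rbig n 0%N; rewrite cats0 rn => /(_ v Xv).
  by rewrite prefix_refl.
exists n; split=> // w Xw; rewrite leqNgt; apply/negP => nw.
have [v Xv vw] := nP (take n w) (size_takel (ltnW nw)).
pose r (k : nat) := take k w ++ nseq (k - size w) i0.
have rk (k : nat) : (k <= size w)%N -> r k = take k w.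
  by rewrite /r -subn_eq0 => /eqP ->; rewrite cats0.
have rayr : ray r.
  split=> [|k]; first by rewrite rk// take0.
  have [kw|wk] := ltnP k (size w).
    by exists (nth i0 w k); rewrite !rk ?(ltnW kw)// -take_nth.
  exists i0; rewrite /r !take_oversize ?subSn ?(leqW wk)//.
  by rewrite rcons_cat -cats1 -[[:: i0]]/(nseq 1 i0) -nseqD addn1.
have [x [_ xP]] := tX r rayr.
have vlt : (size v <= n)%N.
  by have := size_prefix vw; rewrite size_takel// ltnW.
have vE : v = take (size v) w.
  by move: vw; rewrite prefixE take_takel// => /eqP ->.
have xv : x = v.
  apply: xP; split=> //; exists (size v).
  by rewrite rk -?vE// (leq_trans vlt)// ltnW.
have xw : x = w by apply: xP; split=> //; exists (size w); rewrite rk ?take_size.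
by move: vlt; rewrite -xv xw leqNgt nw.
Qed.

End Levels.

(** * Sections and their preimages *)

Section Sections.
Variable d : nat.
Implicit Types (u v w x y z : vertex d) (g h k l a b r : tree_aut d).
Implicit Types (G H K L : set (tree_aut d)) (V X : set (vertex d)).

Lemma sectionM v g h : h v = v -> section v (g * h) = section v g * section v h.
Proof.
move=> hv; apply/esym/section_unique => w.
by rewrite !tree_autME sectionE hv sectionE.
Qed.

Lemma section1 v : section v (1 : tree_aut d) = 1.
Proof. by apply/esym/section_unique. Qed.

Lemma sectionV v g : g v = v -> section v g^-1 = (section v g)^-1.
Proof.
move=> gv; apply: (mulIg (section v g)).
by rewrite -sectionM// !mulVg section1.
Qed.

Lemma agree_section v g h : g v = v -> h v = v ->
  agree v g h <-> section v g = section v h.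
Proof.
move=> gv hv; split=> [gh|e w /prefixP[s ->]].
  by apply: section_unique => w; rewrite -gh ?prefix_prefix// sectionE gv hv.
by rewrite !sectionE gv hv e.
Qed.

Lemma section_subgroup v K : is_subgroup K -> (forall k, K k -> k v = v) ->
  is_subgroup (section v @` K).
Proof.
move=> sK Kv; apply/subgroupP; split=> [|_ _ [g Kg <-] [h Kh <-]|_ [g Kg <-]].
- by exists 1; [exact: subgroup1|exact: section1].
- by exists (g * h); [exact: subgroupM|rewrite sectionM// Kv].
- by exists g^-1; [exact: subgroupV|rewrite sectionV// Kv].
Qed.

(** For K fixing v, this is the preimage in Stab G [set v] of the group of
    sections of K at v. *)
Definition shadow G v K := [set g | G g /\ exists2 k, K k & agree v k g].

Lemma shadow_subgroup G v K : is_subgroup G -> is_subgroup K ->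
  (forall k, K k -> k v = v) -> is_subgroup (shadow G v K).
Proof.
move=> sG sK Kv; apply/subgroupP.
split=> [|g h [Gg [k Kk kg]] [Gh [l Kl lh]]|g [Gg [k Kk kg]]].
- by split; [|exists 1]; try exact: subgroup1.
- split; first exact: subgroupM.
  by exists (k * l); [exact: subgroupM|apply: agreeM => //; apply: Kv].
- split; first exact: subgroupV.
  by exists k^-1; [exact: subgroupV|apply: agreeV => //; apply: Kv].
Qed.

(** Finite index of the sections is read off inside G, where it can be
    intersected with other conditions and used together with density. *)
Lemma shadow_finite_index G v K : is_subgroup G -> is_subgroup K ->
  (forall k, K k -> k v = v) ->
  finite_index (section v @` Stab G [set v]) (section v @` K) ->
  finite_index G (shadow G v K).
Proof.
move=> sG sK Kv fiK; have sS := Stab_subgroup [set v] sG.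
have sSh := shadow_subgroup sG sK Kv.
have SvP g : Stab G [set v] g -> g v = v by case=> _; apply.
have Sh_S : shadow G v K `<=` Stab G [set v].
  by move=> g [Gg [k Kk kg]]; split=> // _ ->; rewrite -(agree_root kg) Kv.
apply: (finite_index_trans sG sS sSh); first exact: Stab_sub.
  apply: (finite_index_sub _ sS _ _ (Stab_level_finite_index (size v) sG)) => //.
    exact: Stab_subgroup.
  by apply: Stab_le => // _ ->.
have [I [f fP]] := (finite_indexP _ (section_subgroup sK Kv)).1 fiK.
apply/finite_indexP => //; exists I, (fun g => f (section v g)) => g h Sg Sh egh.
have Gg := Stab_sub Sg; have Gh := Stab_sub Sh.
have gv := SvP g Sg; have hv := SvP h Sh.
have gv' := tree_autV_fix gv.
have [||k Kk ek] := fP (section v g) (section v h) _ _ egh; [by exists g|by exists h|].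
split; first by apply: (subgroupM sG) => //; apply: subgroupV.
exists k => //; apply/agree_section; [exact: Kv|exact: fixM|].
by rewrite ek sectionM// sectionV.
Qed.

Lemma shadow_finite_index_le G v K K' : is_subgroup G -> is_subgroup K ->
  is_subgroup K' -> K' `<=` K -> (forall k, K k -> k v = v) ->
  finite_index G (shadow G v K) -> finite_index K K' ->
  finite_index G (shadow G v K').
Proof.
move=> sG sK sK' KK Kv fi1 /(finite_indexP K sK')[I [f fP]].
have K'v k : K' k -> k v = v by move=> /KK/Kv.
have sSh := shadow_subgroup sG sK Kv; have sSh' := shadow_subgroup sG sK' K'v.
apply: (finite_index_trans sG sSh sSh' _ fi1); first by move=> g [].
have /choice[s sP] g : exists k, shadow G v K g -> K k /\ agree v k g.
  have [[Gg [k Kk kg]]|nS] := pselect (shadow G v K g); last by exists 1.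
  by exists k.
apply/finite_indexP => //; exists I, (fun g => f (s g)) => g h Sg Sh.
have [Kg gs] := sP g Sg; have [Kh hs] := sP h Sh => /(fP _ _ Kg Kh) Kgh.
split; first by apply: (subgroupM sG); [apply: (subgroupV sG)|]; [case: Sg|case: Sh].
exists ((s g)^-1 * s h) => //; apply: agreeM => //; first exact: Kv.
by apply: agreeV => //; apply: Kv.
Qed.

Lemma shadow_prefix G v w K : prefix v w -> shadow G v K `<=` shadow G w K.
Proof.
by move=> vw g [Gg [k Kk kg]]; split=> //; exists k => //; apply: agree_prefix vw kg.
Qed.

End Sections.

(** * Branch groups *)

Section Branch.
Variables (d : nat) (G : set (tree_aut d)).
Hypotheses (sG : is_subgroup G) (hb : branch G).
Implicit Types (u v w x y z : vertex d) (g h k l a b r : tree_aut d).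
Implicit Types (H K L N : set (tree_aut d)) (V X : set (vertex d)).

(** An infinite group meets each subgroup of finite index nontrivially, by the
    pigeonhole principle. *)
Lemma Rist_finite_index_neq1 v L : is_subgroup L -> finite_index G L ->
  exists2 r, Rist G v r & L r /\ r <> 1.
Proof.
move=> sL fiL; have [_ /(_ v) iR _] := hb.
have RG : Rist G v `<=` G by move=> r [].
have [r [s [Rr Rs nrs Lrs]]] := infinite_pigeonhole sL iR RG fiL.
have sR := Rist_subgroup v sG.
exists (r^-1 * s); first by apply: (subgroupM sR) => //; apply: subgroupV.
by split=> // /mulg1_eq; rewrite invgK.
Qed.

Lemma Rist_neq1 v : exists2 r, Rist G v r & r <> 1.
Proof.
have [|r Rr [_ r1]] := @Rist_finite_index_neq1 v G sG; last by exists r.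
by apply/finite_indexP => //; exists unit, (fun=> tt) => x y Gx Gy _;
  apply: subgroupM => //; apply: subgroupV.
Qed.

(** The commutators of elements of the same Rist_G(y), for y of length m,
    generate a subgroup C normalised by R = Rist_G(L_m), and R/C is abelian
    because distinct Rist_G(y) commute. Being finitely generated and torsion,
    R/C is finite. *)
Lemma finite_index_Rist_commutators H m : finitely_generated G -> torsion G ->
  is_subgroup H -> H `<=` G ->
  (forall y a b, size y = m -> Rist G y a -> Rist G y b -> H [~ a, b]) ->
  finite_index G H.
Proof.
move=> fgG tG sH HG HR; set R := Rist_level G m.
have [_ _ /(_ m) fiR] := hb; rewrite -/R in fiR.
have sR : is_subgroup R := generated_subgroup _.
have RG : R `<=` G by apply: generated_le => // g [v _ []].
have RR v : size v = m -> Rist G v `<=` R.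
  by move=> vm g Rg; apply: generated_sub; exists v.
pose E := [set c | exists y a b, [/\ size y = m, Rist G y a, Rist G y b & c = [~ a, b]]].
pose C := generated E; have sC : is_subgroup C := generated_subgroup _.
have CH : C `<=` H.
  by apply: generated_le => // _ [y [a [b [ym Ra Rb ->]]]]; apply: HR Ra Rb.
have CR : C `<=` R.
  apply: generated_le => // _ [y [a [b [ym Ra Rb ->]]]].
  by apply: (subgroupR sR); apply: (RR y).
have normC g c : R g -> C c -> C (c ^ g).
  apply: generated_conj => {g c} g _ [v vm Rg] [y [a [b [ym Ra Rb ->]]]].
  have Rg' := subgroupV (Rist_subgroup v sG) Rg.
  have J r : Rist G v r -> C ([~ a, b] ^ r).
    move=> Rr; rewrite conjRg; apply: generated_sub; exists y, (a ^ r), (b ^ r).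
    have ry : r^-1 y = y by apply/tree_autV_fix/(Rist_fix Rr); rewrite ym vm.
    by split=> //; rewrite -{1}ry; apply: RistJ => //; case: Rr.
  by split; apply: J.
have CRR k l : R k -> R l -> C [~ k, l].
  apply: commutators_generated => {k l} // a b [v vm Ra] [w wm Rb].
  have [evw|nvw] := pselect (v = w).
    by apply: generated_sub; exists v, a, b; split=> //; rewrite evw.
  have /commgP/eqP -> : commute a b.
    apply: (Rist_commute Ra); apply: (Rist_trivial_off Rb); first by rewrite vm wm.
    exact/nesym.
  exact: (subgroup1 sC).
apply: (finite_index_sub sC sH (fun _ => id) CH).
apply: (finite_index_trans sG sR sC RG fiR).
apply: (finite_index_commutators sR) => //; last by move=> g /RG/tG.
exact: (finite_index_fg sG).
Qed.

(** If N contains g moving y, then by transitivity it has conjugates moving every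
    vertex of the level of y, and it contains all commutators [~ [~ l, a], b]
    with l in N. *)
Lemma branch_just_infinite : finitely_generated G -> torsion G -> just_infinite G.
Proof.
move=> fgG tG; split.
  have [_ /(_ [::]) iR _] := hb; apply: sub_infinite_set iR => g [].
  by [].
move=> N [sN NG nN] N1.
have [g Ng g1] : exists2 g, N g & g <> 1.
  apply: contrapT => nE; apply: N1; apply/seteqP; split=> [g Ng|_ ->]; last exact: subgroup1.
  by apply: contrapT => g1; apply: nE; exists g.
have [y gy] := neq1_moved g1.
apply: (@finite_index_Rist_commutators N (size y)) => // z a b zy Ra Rb.
have [tr _ _] := hb; have [k Gk ky] := tr _ z y zy erefl.
pose l := g ^ k; have Nl : N l by apply: nN.
have lz : l z <> z.
  by rewrite !tree_autME ky => /(congr1 k); rewrite tree_autVK ky.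
rewrite -(commg_Rist sG (NG _ Nl) lz Ra Rb).
have NR c e : N c -> G e -> N [~ c, e].
  by move=> Nc Ge; apply: (subgroupM sN); [exact: subgroupV|exact: nN].
by have [Ga _] := Ra; have [Gb _] := Rb; apply/NR/Gb/NR.
Qed.

End Branch.

(** * Torsion *)

Section Torsion.
Variable d : nat.
Implicit Types (u v w x y z : vertex d) (g h k l a b r : tree_aut d).
Implicit Types (G H K L : set (tree_aut d)) (V X : set (vertex d)).

(** A power of g vanishes on each T_v with v in the transversal. The case of
    trivial sections is clear; in the other case the sections of the cyclic
    group meet those of Rist_G(v0) and Rist_G(v1), and elements with disjoint
    supports have no common powers except the identity. *)
Lemma branch_torsion G : (2 <= d)%N -> is_subgroup G -> branch G ->
  weak_subgroup_induction G -> torsion G.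
Proof.
move=> d2 sG hb ws g Gg; pose H := generated [set g].
have sH : is_subgroup H := generated_subgroup _.
have HG : H `<=` G by apply: generated_le => // _ ->.
have Hg : H g by apply: generated_sub.
have d0 : (0 < d)%N by apply: ltnW.
have [|X tX XP] := ws H sH HG; first by exists [set g]; [exact: finite_set1|].
have [n [Xn nX]] := transversal_bounded d0 tX.
have local v : X v -> exists2 e, (0 < e)%N & agree v (g ^+ e) 1.
  move=> Xv; have [triv|fiv] := XP v Xv.
    have [e e0 [Ge gen]] := finite_index_expg sG (Stab_subgroup (level n) sG)
      (Stab_level_finite_index n sG) Gg.
    exists e => //; have SX : Stab H X (g ^+ e).
      split; first exact: (subgroupX sH).
      move=> x Xx; have Sg : Stab G (level n) (g ^+ e) by [].
      by have [_] := Stab_level_le (Xn x Xx) Sg; apply.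
    apply/agree_section => //; first by case: SX => _; apply.
    rewrite section1; have : [set 1] (section v (g ^+ e)) by rewrite -triv; exists (g ^+ e).
    by [].
  have sS := Stab_subgroup X sH.
  have Sv k : Stab H X k -> k v = v by case=> _; apply.
  have fiS := shadow_finite_index sG sS Sv fiv.
  have sSh := shadow_subgroup sG sS Sv.
  (* The exponent is positive because r is not trivial on T_v. *)
  have power i : exists r e, [/\ Rist G (rcons v i) r, (0 < e)%N & agree v (g ^+ e) r].
    have [r Rr [[_ [k [Hk kX] kr]] r1]] := Rist_finite_index_neq1 sG hb (rcons v i) sSh fiS.
    have kv := kX v Xv; have sR := Rist_subgroup (rcons v i) sG.
    have nz s e : Rist G (rcons v i) s -> s <> 1 -> agree v (g ^+ e) s -> (0 < e)%N.
      move=> Rs s1 es; rewrite lt0n; apply/eqP => e0.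
      have [z sz] := neq1_moved s1; have := Rist_moved (Rist_le (prefix_rcons v i) Rs) sz.
      by move=> /es; rewrite e0 => /esym/sz.
    have [e [ke|ke]] := mem_cyclic Hk.
      by exists r, e; rewrite -ke; split=> //; apply: (nz r) => //; rewrite -ke.
    have kr' := agreeV kv kr; have Rr' := subgroupV sR Rr.
    exists r^-1, e; rewrite -ke; split=> //; apply: (nz r^-1) => //; last by rewrite -ke.
    by move=> /(congr1 inv); rewrite invgK invg1.
  have [r0 [e0 [R0 e0_gt ae0]]] := power (Ordinal d0).
  have [r1 [e1 [R1 e1_gt ae1]]] := power (Ordinal d2).
  have fixg r i e : Rist G (rcons v i) r -> agree v (g ^+ e) r -> (g ^+ e) v = v.
    by move=> Rr /agree_root ->; apply: (Rist_fix Rr); rewrite size_rcons.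
  exists (e0 * e1)%N; first by rewrite muln_gt0 e0_gt.
  have a0 := agreeX e1 (fixg _ _ _ R0 ae0) ae0.
  have a1 := agreeX e0 (fixg _ _ _ R1 ae1) ae1.
  rewrite -expgnA in a0; rewrite -expgnA mulnC in a1.
  have [_ R0'] := subgroupX (Rist_subgroup _ sG) e1 R0.
  have [_ R1'] := subgroupX (Rist_subgroup _ sG) e0 R1.
  (* On T_v the power g^(e0 e1) agrees both with r0^e1, supported below the
     child 0 of v, and with r1^e0, supported below the child 1. *)
  move=> w vw; have [w0|w0] := boolP (prefix (rcons v (Ordinal d0)) w).
    rewrite a1// R1'//; apply/negP => w1.
    have : rcons v (Ordinal d0) = rcons v (Ordinal d2).
      by apply: prefix_eq_size w0 w1 _; rewrite !size_rcons.
    by case/rcons_inj.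
  by rewrite a0// R0'.
have /choice[m mP] (t : n.-tuple 'I_d) : exists m, (0 < m)%N /\ agree t (g ^+ m) 1.
  have [v Xv vt] := nX t (size_tuple t); have [e e0 ge] := local v Xv.
  by exists e; split=> //; apply: agree_prefix vt ge.
(* A common multiple of the exponents that work on the subtrees at level n. *)
exists (\prod_t m t)%N; first by apply: prodn_gt0 => t; case: (mP t).
apply: (@agree_levelP _ n) => // w wn.
rewrite (bigD1 (Tuple (introT eqP wn)))//= expgnA.
have [_ /= mw] := mP (Tuple (introT eqP wn)).
have := @agreeX _ w _ 1 (\prod_(t | t != Tuple (introT eqP wn)) m t)%N _ mw.
by rewrite expg1n; apply; rewrite (agree_root mw).
Qed.

End Torsion.

(** * Finitely generated subgroups dense in the profinite topology *)

Section ProDense.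
Variables (d : nat) (G H : set (tree_aut d)) (n : nat).
Hypotheses (d0 : (0 < d)%N).
Hypotheses (sG : is_subgroup G) (hb : branch G).
Hypotheses (sH : is_subgroup H) (HG : H `<=` G).
Hypothesis dense : forall L, is_subgroup L -> finite_index G L ->
  forall g, G g -> exists h l, [/\ H h, G l, L l & g = h * l].
Hypothesis sections_fi : forall w m, size w = n -> (n <= m)%N ->
  finite_index G (shadow G w (Stab H (level m))).
Implicit Types (u v w x y z : vertex d) (g h k l a b r : tree_aut d).
Implicit Types (L : set (tree_aut d)).

Let S := Stab H (level n).

Lemma subS : is_subgroup S. Proof. exact: Stab_subgroup. Qed.

Lemma S_fix h w : S h -> (size w <= n)%N -> h w = w.
Proof. by move=> Sh wn; have [_] := Stab_level_le wn Sh; apply. Qed.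

Lemma dense_transitive v w : size v = size w -> exists2 h, H h & h v = w.
Proof.
move=> vw; have [tr _ _] := hb; have [g Gg gv] := tr _ v w vw erefl.
have [h [l [Hh _ [_ lv] gE]]] :=
  dense (Stab_subgroup (level (size v)) sG) (Stab_level_finite_index (size v) sG) Gg.
by exists h => //; rewrite -gv gE tree_autME lv.
Qed.

Lemma shadow_level_subgroup w m : size w = n -> (n <= m)%N ->
  is_subgroup (shadow G w (Stab H (level m))).
Proof.
move=> wn nm; apply: shadow_subgroup => //; first exact: Stab_subgroup.
by move=> k /(Stab_level_le nm) Sk; apply: S_fix; rewrite ?wn.
Qed.

(** The sections of H at w form a subgroup of finite index in those of G which
    is also dense in them. *)
Lemma dense_sections w g : size w = n -> G g -> g w = w ->
  exists2 h, H h & agree w h g.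
Proof.
move=> wn Gg gw.
have [h [l [Hh Gl [_ [k [Hk _] kl]] gE]]] :=
  dense (shadow_level_subgroup wn (leqnn n)) (sections_fi wn (leqnn n)) Gg.
exists (h * k); first exact: subgroupM.
by move=> u wu; rewrite gE !tree_autME kl.
Qed.

(** Take r in Rist_G(u) moving y, and write r = h l with l in a subgroup of
    finite index so small that l fixes the level of y and that on T_w' it agrees
    with some k of H fixing that level too. On T_w' the element h is the inverse
    of l, so k h is trivial there, while it moves y as r does. *)
Lemma dense_independent w w' u : size w = n -> size w' = n -> w <> w' ->
  prefix w u ->
  exists2 h, S h & agree w' h 1 /\ exists2 y, prefix u y & h y <> y.
Proof.
move=> wn w'n ww' wu.
have [r Rr r1] := Rist_neq1 sG hb u.
have [y ry] := neq1_moved r1; have uy := Rist_moved Rr ry.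
have nu : (n <= size u)%N by rewrite -wn size_prefix.
have nm : (n <= size y)%N by apply: leq_trans nu _; apply: size_prefix.
have sSh := shadow_level_subgroup w'n nm.
have sSt := Stab_subgroup (level (size y)) sG.
have [h [l [Hh Gl [[_ [k Hk kl]] [_ lm]] rE]]] :=
  dense (subgroupI sSh sSt)
    (finite_indexI sSh sSt (sections_fi w'n nm) (Stab_level_finite_index _ sG)) Rr.1.
have hE : h = r * l^-1 by rewrite rE mulgK.
have Sk := Stab_level_le nm Hk.
have Sh : S h.
  split=> // v vn; rewrite hE; apply: fixM.
    by apply: (Rist_fix Rr); rewrite (vn : size v = n).
  apply: tree_autV_fix.
  have [_] := Stab_level_le (G := G) nm (conj Gl lm); exact.
have kw' : k w' = w' by apply: (S_fix Sk); rewrite w'n.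
have lw' : l^-1 w' = w' by apply: tree_autV_fix; rewrite -(agree_root kl).
have ly : l^-1 y = y by apply/tree_autV_fix/lm.
exists (k * h); first exact: (subgroupM subS).
rewrite hE; split=> [v w'v|].
  have w'lv : prefix w' (l^-1 v) by rewrite -lw' prefix_tree_aut.
  rewrite !tree_autME [r _](Rist_trivial_off (Rist_le wu Rr) _ _ w'lv) ?wn ?w'n//.
  by rewrite kl// tree_autVK.
exists y => //; rewrite !tree_autME ly; have [_ ->//] := Hk.
by rewrite /level/= size_tree_aut.
Qed.

Lemma dense_Rist w x : size w = n -> prefix w x ->
  exists r h, [/\ Rist G x r, r <> 1, S h & agree w h r].
Proof.
move=> wn wx.
have [r Rr [[_ [h Sh hr]] r1]] := Rist_finite_index_neq1 sG hb x
  (shadow_level_subgroup wn (leqnn n)) (sections_fi wn (leqnn n)).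
by exists r, h.
Qed.

(** With l trivial on T_w' and moving y, and rigid a, b below y realised on T_w
    by elements ka, kb of S, the commutator [~ [~ l, ka], kb] is trivial on T_w'
    because l is, and acts on T_w as [~ a, b]. *)
Lemma dense_Rist_off1 w w' x : size w = n -> size w' = n -> w <> w' ->
  prefix w x ->
  exists r h, [/\ Rist G x r, r <> 1, S h, agree w h r & agree w' h 1].
Proof.
move=> wn w'n ww' wx.
have [l Sl [lw' [y xy ly]]] := dense_independent wn w'n ww' wx.
have wy := prefix_trans wx xy.
have [a [ka [Ra a1 Sa aw]]] := dense_Rist wn wy.
have [z az] := neq1_moved a1; have yz := Rist_moved Ra az.
have [b [kb [Rb b1 Sb bw]]] := dense_Rist wn (prefix_trans wy yz).
have Sfix h v : S h -> size v = n -> h v = v by move=> Sh vn; apply: S_fix; rewrite ?vn.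
have Rb' := Rist_le yz Rb.
have Ga : G a by case: Ra.
exists [~ a, b], [~ [~ l, ka], kb]; split.
- exact: (subgroupR (Rist_subgroup x sG)) (Rist_le xy Ra) (Rist_le xy Rb').
- exact: commg_Rist_neq1 az Rb b1.
- by apply: (subgroupR subS) => //; apply: (subgroupR subS).
- rewrite -(commg_Rist sG (HG Sl.1) ly Ra Rb').
  by apply: agreeR => //; [apply: fixR| |apply: agreeR]; rewrite ?Sfix//; apply: Sfix.
- have -> : 1 = [~ [~ 1, ka], kb] by rewrite !comm1g.
  by apply: agreeR => //; [apply: fixR| |apply: agreeR]; rewrite ?Sfix//; apply: Sfix.
Qed.

(** Induction on s: the next vertex is dealt with by the commutator of the element
    at hand, which moves some y, with an element rigid below y. A commutator is
    trivial wherever one of its two entries is. *)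
Lemma dense_Rist_off w (s : seq (vertex d)) x : size w = n ->
  (forall w', w' \in s -> size w' = n /\ w <> w') -> prefix w x ->
  exists r h, [/\ Rist G x r, r <> 1, S h, agree w h r &
    forall w', w' \in s -> agree w' h 1].
Proof.
move=> wn; have Sfix h v : S h -> size v = n -> h v = v.
  by move=> Sh vn; apply: S_fix; rewrite ?vn.
elim: s x => [|w' s IH] x sP wx.
  by have [r [h [Rr r1 Sh hr]]] := dense_Rist wn wx; exists r, h.
have [|a [ka [Ra a1 Sa aw off]]] := IH x _ wx.
  by move=> v vs; apply: sP; rewrite in_cons vs orbT.
have [y ay] := neq1_moved a1; have xy := Rist_moved Ra ay.
have [w'n ww'] := sP w' (mem_head _ _).
have [b [kb [Rb b1 Sb bw bw']]] := dense_Rist_off1 wn w'n ww' (prefix_trans wx xy).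
have Ga : G a by case: Ra.
exists [~ a, b], [~ ka, kb]; split.
- exact: (subgroupR (Rist_subgroup x sG)) Ra (Rist_le xy Rb).
- exact: commg_Rist_neq1 ay Rb b1.
- exact: (subgroupR subS).
- by apply: agreeR => //; apply: Sfix.
- move=> v; rewrite in_cons => /predU1P[->|vs].
    have -> : 1 = [~ ka, 1] by rewrite commg1.
    by apply: agreeR => //; apply: Sfix.
  have vn : size v = n by have [] := sP v; rewrite ?in_cons ?vs ?orbT.
  have -> : 1 = [~ 1, kb] by rewrite comm1g.
  by apply: agreeR => //; [exact: Sfix|exact: Sfix|exact: off].
Qed.

(** Take for s all other vertices of the level of w. *)
Lemma dense_meets_Rist w : size w = n -> exists2 r, Rist H w r & r <> 1.
Proof.
move=> wn.
pose s := [seq val t | t <- enum {: n.-tuple 'I_d} & val t != w].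
have [|r [h [[Gr Rr] r1 Sh hr off]]] := @dense_Rist_off w s w wn _ (prefix_refl w).
  move=> _ /mapP[t + ->]; rewrite mem_filter => /andP[/eqP/nesym tw _].
  by rewrite size_tuple.
have hE : h = r.
  apply: (@agree_levelP _ n) => // v vn; have [->//|vw] := eqVneq v w.
  apply: (@agree_trans _ _ _ 1).
    apply: off; apply/mapP; exists (Tuple (introT eqP vn)) => //.
    by rewrite mem_filter /= vw mem_enum.
  apply: agree_sym => u vu; apply/Rr; apply/negP => wu.
  by move/eqP: vw; apply; apply: prefix_eq_size vu wu _; rewrite vn wn.
by exists r => //; split=> //; rewrite -hE; case: Sh.
Qed.

(** For l in Rist_H(w) the commutator [~ l, g] only depends on the restriction of
    g to T_w, where elements of G can be replaced by elements of H. If l moves x,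
    this applies to [~ [~ l, a], b] for a, b in Rist_G(x). *)
Lemma dense_Rist_commutators : exists m, forall y a b, size y = m ->
  Rist G y a -> Rist G y b -> H [~ a, b].
Proof.
pose w := nseq n (Ordinal d0); have wn : size w = n by rewrite size_nseq.
have [r RHr r1] := dense_meets_Rist wn.
have [Hr _] := RHr; have Rr : Rist G w r by case: RHr => /HG.
have [x rx] := neq1_moved r1; have wx := Rist_moved Rr rx.
have commS l g : H l -> Rist G w l -> Rist G w g -> H [~ l, g].
  move=> Hl Rl Rg; have [Gg _] := Rg.
  have gw : g w = w by apply: (Rist_fix Rg).
  have [h Hh hg] := dense_sections wn Gg gw.
  have hw : h w = w by rewrite (agree_root hg).
  suff -> : [~ l, g] = [~ l, h] by apply: subgroupR.
  (* The quotient of h and g is trivial on T_w, which supports l. *)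
  have lE : commute l (h * g^-1).
    apply: (Rist_commute Rl); rewrite -(mulgV h).
    by apply: agreeM; [exact: tree_autV_fix| |by apply: agreeV => //; apply: agree_sym].
  rewrite !commgEl; congr (_ * _); rewrite -[h in RHS](mulgVK g) conjgM.
  by congr (_ ^ _); apply/esym; rewrite conjgE lE mulKg.
have Cx a b : Rist G x a -> Rist G x b -> H [~ a, b].
  move=> Ra Rb; rewrite -(commg_Rist sG (HG Hr) rx Ra Rb).
  have Ra' := Rist_le wx Ra; have Rb' := Rist_le wx Rb.
  apply: (commS) => //; first exact: commS.
  exact: (subgroupR (Rist_subgroup w sG)).
exists (size x) => y a b yx Ra Rb.
have [h Hh hx] := dense_transitive (esym yx).
have hy : h^-1 y = x by rewrite -hx tree_autK.
have : H [~ a ^ h, b ^ h].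
  by apply: Cx; rewrite -hy; apply: RistJ => //; apply: HG.
move=> /(subgroupJ sH)/(_ (subgroupV sH Hh)).
by rewrite -conjRg -conjgM mulgV conjg1.
Qed.

Lemma dense_full : finitely_generated G -> torsion G -> H = G.
Proof.
move=> fgG tG; have [m Hm] := dense_Rist_commutators.
have fiH := finite_index_Rist_commutators sG hb fgG tG sH HG Hm.
apply/seteqP; split=> // g Gg; have [h [l [Hh _ Hl ->]]] := dense sH fiH Gg.
exact: subgroupM.
Qed.

End ProDense.

Section Maximal.
Variables (d : nat) (G : set (tree_aut d)).
Implicit Types (u v w x y z : vertex d) (g h k l a b r : tree_aut d).
Implicit Types (H K L M N : set (tree_aut d)) (V X : set (vertex d)).

(** If the section group of Stab_H(X) at one v in X were trivial, then so would
    be those of S = Stab_H(L_n) at all vertices of level n, by transitivity, and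
    S = 1. But S contains an element moving some y below level n, by density
    applied to a rigid element and to the stabiliser of the level of y. *)
Lemma fg_dense_full H : (0 < d)%N -> is_subgroup G -> branch G ->
  finitely_generated G -> torsion G -> weak_subgroup_induction G ->
  is_subgroup H -> H `<=` G -> finitely_generated H ->
  (forall L, is_subgroup L -> finite_index G L ->
     forall g, G g -> exists h l, [/\ H h, G l, L l & g = h * l]) ->
  H = G.
Proof.
move=> d0 sG hb fgG tG ws sH HG fgH dense.
have [X tX XP] := ws H sH HG fgH.
have [n [Xn nX]] := transversal_bounded d0 tX.
have sS := Stab_subgroup (level n) sH; have sSX := Stab_subgroup X sH.
have S_X m : (n <= m)%N -> Stab H (level m) `<=` Stab H X.
  move=> nm k Hk; split=> [|x Xx]; first by case: Hk.
  by have [_] := Stab_level_le (leq_trans (Xn x Xx) nm) Hk; apply.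
have SXv v k : X v -> Stab H X k -> k v = v by move=> Xv [_]; apply.
have fi_sections v : X v ->
    finite_index (section v @` Stab G [set v]) (section v @` Stab H X).
  move=> Xv; have [triv|//] := XP v Xv; exfalso.
  pose w := v ++ nseq (n - size v) (Ordinal d0).
  have wn : size w = n by rewrite size_cat size_nseq subnKC// Xn.
  have vw : prefix v w by apply: prefix_prefix.
  have S1 h : Stab H (level n) h -> h = 1.
    move=> Sh; apply: (@agree_levelP _ n) => // u un.
    have [k Hk kw] := dense_transitive sG hb dense (etrans wn (esym un)).
    have Shk : Stab H (level n) (h ^ k).
      split; first by apply: (subgroupJ sH) => //; case: Sh.
      move=> z zn; rewrite !tree_autME; have [_ ->] := Sh; first by rewrite tree_autK.
      by rewrite /level/= size_tree_aut.
    have SXhk := S_X n (leqnn n) _ Shk.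
    have e1 : section v (h ^ k) = section v 1.
      have : (section v @` Stab H X) (section v (h ^ k)) by exists (h ^ k).
      by rewrite triv section1.
    have hk1 : agree v (h ^ k) 1 by apply/agree_section => //; apply: SXv Xv SXhk.
    move=> z uz; have := hk1 (k^-1 z); rewrite !tree_autME tree_autVK => kz.
    apply: (@tree_aut_inj _ k^-1); apply: kz; apply: prefix_trans vw _.
    by rewrite -(tree_autK k w) prefix_tree_aut kw.
  have [r Rr r1] := Rist_neq1 sG hb w; have [y ry] := neq1_moved r1.
  have [h [l [Hh Gl [_ ly] rE]]] :=
    dense _ (Stab_subgroup (level (size y)) sG) (Stab_level_finite_index (size y) sG) r Rr.1.
  have ny : (n <= size y)%N by rewrite -wn size_prefix// (Rist_moved Rr ry).
  apply: ry; rewrite rE tree_autME ly// (S1 h)//.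
  have -> : h = r * l^-1 by rewrite rE mulgK.
  split=> [|z zn]; first by rewrite rE mulgK.
  apply: fixM; first by apply: (Rist_fix Rr); rewrite (zn : size z = n) wn.
  apply: tree_autV_fix.
  have [|_] := @Stab_level_le _ G n (size y) ny l; [by split|exact].
apply: (@dense_full _ G H n) => // w m wn nm.
have [v Xv vw] := nX w wn.
have sM := Stab_subgroup (level m) sH.
have Sv k : Stab H X k -> k v = v by apply: SXv.
have fi1 := shadow_finite_index sG sSX Sv (fi_sections v Xv).
have fi2 : finite_index (Stab H X) (Stab H (level m)).
  apply: (finite_index_sub sM sM _ _ (Stab_level_finite_index m sH)) => //.
  exact: Stab_sub.
have fi3 := shadow_finite_index_le sG sSX sM (S_X m nm) Sv fi1 fi2.
have sM1 : is_subgroup (shadow G v (Stab H (level m))).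
  by apply: shadow_subgroup => // k /(S_X m nm); apply: Sv.
apply: (finite_index_sub sM1 _ _ _ fi3) => //; last exact: shadow_prefix.
apply: shadow_subgroup => // k Sk; have [_] := Stab_level_le nm Sk; exact.
Qed.

End Maximal.

(** * The theorem *)

Theorem theorem1p1 (d : nat) (hd : (2 <= d)%N) (G : set (tree_aut d))
    (hG : is_subgroup G) (hfg : finitely_generated G) (hbranch : branch G)
    (hwsip : weak_subgroup_induction G) :
  [/\ torsion G,
      just_infinite G,
      finite_index_Frattini G <> [set 1] ->
        forall M : set (tree_aut d), maximal_subgroup G M -> finite_index G M &
      forall p : nat, prime p -> p_group p G ->
        finite_index_Frattini G <> [set 1]].
Proof.
have d0 : (0 < d)%N by apply: ltnW.
have tG := branch_torsion hd hG hbranch hwsip.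
have jiG := branch_just_infinite hG hbranch hfg tG.
split=> // [F1 M maxM|p p_pr pG F1].
  apply: contrapT => nfi.
  have fiF : finite_index G (finite_index_Frattini G).
    by apply: jiG.2 F1; apply: finite_index_Frattini_normal.
  have [H [sH HM fgH dense]] := maximal_infinite_index_dense hG hfg fiF maxM nfi.
  have [_ [MG nGM] _] := maxM.
  have HG : H `<=` G by move=> x /HM/MG.
  apply: nGM; rewrite -(fg_dense_full d0 hG hbranch hfg tG hwsip sH HG fgH dense).
  exact: HM.
have [a [Ga _] a1] := Rist_neq1 hG hbranch [::].
have [y ay] := neq1_moved a1.
have [b Rb b1] := Rist_neq1 hG hbranch y.
have Gb : G b by case: Rb.
apply: (commg_Rist_neq1 hG Ga ay Rb b1).
have : finite_index_Frattini G [~ a, b].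
  split; first exact: subgroupR.
  by move=> M [maxM fiM]; apply: (p_group_maximal_commutator p_pr hG pG maxM fiM).
by rewrite F1.
Qed.
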